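(* Let $\Gamma$ be a group or a monoid and $n$ a positive integer. The representation variety with Borel mold $\mathrm{Rep}_n(\Gamma)_B$ has a unique complete flag of $\Gamma$-invariant subbundles $$0\subseteq \mathcal{E}_{\Gamma,n}^{(1)}\subseteq\cdots\subseteq \mathcal{E}_{\Gamma,n}^{(n-1)}\subseteq \mathcal{O}_{\mathrm{Rep}_n(\Gamma)_B}^{\oplus n}$$ (with $\mathcal{E}_{\Gamma,n}^{(i)}$ of rank $i$), and it has the following universal property: for any scheme $X$ and any representation $\rho$ of degree $n$ with Borel mold for $\Gamma$ on $X$, the unique $\Gamma$-invariant subbundle $\mathcal{E}_i\subseteq\mathcal{O}_X^{\oplus n}$ of rank $i$ on $X$ is obtained as $f^{*}\mathcal{E}_{\Gamma,n}^{(i)}$, where $f:X\to \mathrm{Rep}_n(\Gamma)_B$ is the morphism associated to $\rho$.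
   Context: Let $X$ be a scheme. A representation of degree $n$ for a group (resp. monoid) $\Gamma$ on $X$ is a group homomorphism $\rho:\Gamma\to \mathrm{GL}_n(\Gamma(X,\mathcal{O}_X))$ (resp. a monoid homomorphism $\rho:\Gamma\to \mathrm{M}_n(\Gamma(X,\mathcal{O}_X))$). A mold of degree $n$ on $X$ is a subsheaf of $\mathcal{O}_X$-algebras (containing the identity matrix) $\mathcal{A}\subseteq \mathrm{M}_n(\mathcal{O}_X)$ such that $\mathcal{A}$ and $\mathrm{M}_n(\mathcal{O}_X)/\mathcal{A}$ are locally free sheaves. Two molds $\mathcal{A},\mathcal{B}$ of degree $n$ on $X$ are locally equivalent if every $x\in X$ has an open neighborhood $U$ and some $P_U\in \mathrm{GL}_n(\mathcal{O}_U)$ with $P_U^{-1}(\mathcal{A}|_U)P_U=\mathcal{B}|_U$. Let $\mathcal{B}_n\subset \mathrm{M}_n(\mathbb{Z})$ be the subalgebra of upper triangular matrices. A Borel mold of degree $n$ on $X$ is a mold locally equivalent to $\mathcal{B}_n\otimes_{\mathbb{Z}}\mathcal{O}_X$. A representation with Borel mold on $X$ is a representation $\rho$ of degree $n$ on $X$ such that the subsheaf of $\mathcal{O}_X$-algebras $\mathcal{O}_X[\rho(\Gamma)]\subseteq \mathrm{M}_n(\mathcal{O}_X)$ generated by $\rho(\Gamma)$ is a Borel mold. $\mathrm{Rep}_n(\Gamma)_B$ is the scheme over $\mathbb{Z}$ representing the contravariant functor sending a scheme $X$ to the set of degree $n$ representations with Borel mold for $\Gamma$ on $X$; it is a subscheme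 of the affine scheme $\mathrm{Rep}_n(\Gamma)$ representing all degree $n$ representations of $\Gamma$. For a representation $\rho$ on $X$, $\Gamma$ acts on $\mathcal{O}_X^{\oplus n}$ via $\Gamma\xrightarrow{\rho}\mathrm{M}_n(\Gamma(X,\mathcal{O}_X))=\mathrm{End}_{\mathcal{O}_X}(\mathcal{O}_X^{\oplus n})$; on $\mathrm{Rep}_n(\Gamma)_B$ this is done with the universal representation. A subbundle of $\mathcal{O}_X^{\oplus n}$ is a locally free subsheaf with locally free quotient. For a representation with Borel mold on $X$ there is, for each $1\le i<n$, a unique $\Gamma$-invariant subbundle of $\mathcal{O}_X^{\oplus n}$ of rank $i$. *)

(* Defs.v *)
From HB Require Import structures.
From mathcomp Require Import all_boot all_algebra.
From mathcomp Require Import ring.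
From mathcomp Require Import boolp classical_sets filter topology.

Set Implicit Arguments.
Unset Strict Implicit.
Unset Printing Implicit Defensive.

Import GRing.Theory.
Local Open Scope classical_set_scope.
Local Open Scope ring_scope.
Local Open Scope quotient_scope.

Identity Coercion set_to_fun : set >-> Funclass.

(** Rings are [comPzRingType]s because the zero ring must be allowed (it is the
    ring of sections over the empty set). *)

Record mult_set (R : comPzRingType) := MultSet {
  mset :> set R;
  mset1 : mset 1;
  msetM : forall s t, mset s -> mset t -> mset (s * t) }.

Section Localization.
Variables (R : comPzRingType) (S : mult_set R).

Record fraction := Fraction { fnum : R; fden : R; fdenP : S fden }.

HB.instance Definition _ := gen_eqMixin fraction.
HB.instance Definition _ := gen_choiceMixin fraction.

Definition frac_equiv (x y : fraction) : bool :=
  `[< exists2 u, S u & u * (fnum x * fden y) = u * (fnum y * fden x) >].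

Lemma frac_equivP x y :
  reflect (exists2 u, S u & u * (fnum x * fden y) = u * (fnum y * fden x))
          (frac_equiv x y).
Proof. exact: asboolP. Qed.

Lemma frac_equiv_refl : reflexive frac_equiv.
Proof. by move=> x; apply/frac_equivP; exists 1 => //; exact: mset1. Qed.

Lemma frac_equiv_sym : symmetric frac_equiv.
Proof.
by move=> x y; apply/frac_equivP/frac_equivP => -[u Su e]; exists u.
Qed.

Lemma frac_equiv_trans : transitive frac_equiv.
Proof.
move=> y x z /frac_equivP[u Su e] /frac_equivP[v Sv e'].
apply/frac_equivP; exists (u * v * fden y).
  by apply: msetM; [exact: msetM | exact: fdenP].
transitivity (u * (fnum x * fden y) * (v * fden z)); first by ring.
rewrite e; transitivity (v * (fnum y * fden z) * (u * fden x)); first by ring.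
by rewrite e'; ring.
Qed.

Canonical frac_equiv_equiv :=
  EquivRel frac_equiv frac_equiv_refl frac_equiv_sym frac_equiv_trans.

Definition localization := {eq_quot frac_equiv}.
HB.instance Definition _ : EqQuotient _ frac_equiv localization :=
  EqQuotient.on localization.
HB.instance Definition _ := Choice.on localization.

Definition mkfrac (a s : R) (Ss : S s) : localization :=
  \pi_localization (Fraction a Ss).

Lemma mkfrac_eqP a s (Ss : S s) b t (St : S t) :
  mkfrac a Ss = mkfrac b St <-> exists2 u, S u & u * (a * t) = u * (b * s).
Proof.
split=> [/eqmodP/= /frac_equivP//|h].
by apply/eqmodP/frac_equivP.
Qed.

Lemma mkfracP (x : localization) : exists a s (Ss : S s), x = mkfrac a Ss.
Proof. by elim/quotW: x => -[a s Ss]; exists a, s, Ss. Qed.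

Definition loc_add (x y : localization) : localization :=
  mkfrac (fnum (repr x) * fden (repr y) + fnum (repr y) * fden (repr x))
         (msetM (fdenP (repr x)) (fdenP (repr y))).
Definition loc_mul (x y : localization) : localization :=
  mkfrac (fnum (repr x) * fnum (repr y))
         (msetM (fdenP (repr x)) (fdenP (repr y))).
Definition loc_opp (x : localization) : localization :=
  mkfrac (- fnum (repr x)) (fdenP (repr x)).

Lemma repr_mkfrac a s (Ss : S s) :
  exists2 u, S u & u * (fnum (repr (mkfrac a Ss)) * s) =
                   u * (a * fden (repr (mkfrac a Ss))).
Proof.
apply/(mkfrac_eqP _ (fdenP (repr (mkfrac a Ss))) _ Ss).
rewrite -[RHS]reprK /mkfrac; congr (\pi _).
by case: (repr _).
Qed.

Lemma loc_addE a s (Ss : S s) b t (St : S t) :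
  loc_add (mkfrac a Ss) (mkfrac b St) = mkfrac (a * t + b * s) (msetM Ss St).
Proof.
have [u Su e] := repr_mkfrac a Ss; have [v Sv e'] := repr_mkfrac b St.
apply/mkfrac_eqP; exists (u * v); first exact: msetM.
set x := repr (mkfrac a Ss) in e *; set y := repr (mkfrac b St) in e' *.
transitivity (u * (fnum x * s) * (v * fden y * t) +
              v * (fnum y * t) * (u * fden x * s)); first by ring.
by rewrite e e'; ring.
Qed.

Lemma loc_mulE a s (Ss : S s) b t (St : S t) :
  loc_mul (mkfrac a Ss) (mkfrac b St) = mkfrac (a * b) (msetM Ss St).
Proof.
have [u Su e] := repr_mkfrac a Ss; have [v Sv e'] := repr_mkfrac b St.
apply/mkfrac_eqP; exists (u * v); first exact: msetM.
set x := repr (mkfrac a Ss) in e *; set y := repr (mkfrac b St) in e' *.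
transitivity (u * (fnum x * s) * (v * (fnum y * t))); first by ring.
by rewrite e e'; ring.
Qed.

Lemma loc_oppE a s (Ss : S s) : loc_opp (mkfrac a Ss) = mkfrac (- a) Ss.
Proof.
have [u Su e] := repr_mkfrac a Ss.
apply/mkfrac_eqP; exists u => //.
by rewrite !mulNr !mulrN e.
Qed.

Local Ltac loc_frac x :=
  let a := fresh "a" in let s := fresh "s" in let Ss := fresh "Ss" in
  have [a [s [Ss ->]]] := mkfracP x.
Local Ltac loc_eq :=
  rewrite ?(loc_addE, loc_mulE, loc_oppE);
  apply/mkfrac_eqP; exists 1; [exact: mset1 | ring].

Lemma loc_addA : associative loc_add.
Proof. by move=> x y z; loc_frac x; loc_frac y; loc_frac z; loc_eq. Qed.
Lemma loc_addC : commutative loc_add.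
Proof. by move=> x y; loc_frac x; loc_frac y; loc_eq. Qed.
Lemma loc_add0 : left_id (mkfrac 0 (mset1 S)) loc_add.
Proof. by move=> x; loc_frac x; loc_eq. Qed.
Lemma loc_addN : left_inverse (mkfrac 0 (mset1 S)) loc_opp loc_add.
Proof. by move=> x; loc_frac x; loc_eq. Qed.
Lemma loc_mulA : associative loc_mul.
Proof. by move=> x y z; loc_frac x; loc_frac y; loc_frac z; loc_eq. Qed.
Lemma loc_mulC : commutative loc_mul.
Proof. by move=> x y; loc_frac x; loc_frac y; loc_eq. Qed.
Lemma loc_mul1 : left_id (mkfrac 1 (mset1 S)) loc_mul.
Proof. by move=> x; loc_frac x; loc_eq. Qed.
Lemma loc_mulD : left_distributive loc_mul loc_add.
Proof. by move=> x y z; loc_frac x; loc_frac y; loc_frac z; loc_eq. Qed.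

HB.instance Definition _ :=
  GRing.isZmodule.Build localization loc_addA loc_addC loc_add0 loc_addN.
HB.instance Definition _ :=
  GRing.Zmodule_isComPzRing.Build localization loc_mulA loc_mulC loc_mul1
    loc_mulD.

End Localization.

Record opens (X : topologicalType) := Opens { oset :> set X; openP : open oset }.

Definition opensT (X : topologicalType) : opens X := Opens (@openT X).

Lemma open_preim (X Y : topologicalType) (f : X -> Y) (cf : continuous f)
  (V : opens Y) : open (f @^-1` V).
Proof. by move/continuousP: cf; apply; exact: openP. Qed.

Definition preim_opens (X Y : topologicalType) (f : X -> Y) (cf : continuous f)
  (V : opens Y) : opens X := Opens (open_preim cf V).

Section Presheaf.
Variables (X : topologicalType) (F : opens X -> Type).
Variable res : forall U V : opens X, V `<=` U -> F U -> F V.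

Definition is_presheaf :=
  (forall (U : opens X) (h : U `<=` U) s, res h s = s) /\
  (forall (U V W : opens X) (h : V `<=` U) (k : W `<=` V) (l : W `<=` U) s,
     res k (res h s) = res l s).

Definition is_sheaf :=
  forall (I : Type) (U : opens X) (V : I -> opens X)
         (VU : forall i, V i `<=` U),
  U `<=` \bigcup_i V i ->
  forall s : forall i, F (V i),
  (forall i j (W : opens X) (Wi : W `<=` V i) (Wj : W `<=` V j),
     res Wi (s i) = res Wj (s j)) ->
  exists! t : F U, forall i, res (VU i) t = s i.

End Presheaf.

Record ringed_space := RingedSpace {
  rs_top :> topologicalType;
  Osec : opens rs_top -> comPzRingType;
  Ores : forall U V : opens rs_top, V `<=` U -> {rmorphism Osec U -> Osec V};
  Ores_presheaf : is_presheaf (fun U V (h : V `<=` U) => Ores h : Osec U -> Osec V);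
  Ores_sheaf : is_sheaf (fun U V (h : V `<=` U) => Ores h : Osec U -> Osec V) }.

Record ringed_mor (X Y : ringed_space) := RingedMor {
  rm_fun :> X -> Y;
  rm_cont : continuous rm_fun;
  rm_sharp : forall V : opens Y,
    {rmorphism Osec V -> Osec (preim_opens rm_cont V)};
  rm_res : forall (V W : opens Y) (h : W `<=` V)
    (k : preim_opens rm_cont W `<=` preim_opens rm_cont V) (s : Osec V),
    rm_sharp W (Ores h s) = Ores k (rm_sharp V s) }.

Arguments rm_cont {X Y} r.

(** The germ at [x] of the section [s] is a unit of the stalk at [x]. *)
Definition germ_unit (X : ringed_space) (U : opens X) (s : Osec U) (x : X) :=
  exists (V : opens X) (h : V `<=` U) (t : Osec V), V x /\ Ores h s * t = 1.

(** All stalks are local rings: they are nonzero, and the sum of two nonunits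
    is a nonunit. Two germs at [x] are represented on a common [U]. *)
Definition locally_ringed (X : ringed_space) :=
  forall (x : X) (U : opens X), U x ->
    ~ germ_unit (0 : Osec U) x /\
    forall s t : Osec U,
      ~ germ_unit s x -> ~ germ_unit t x -> ~ germ_unit (s + t) x.

Record prime_ideal (R : comPzRingType) := PrimeIdeal {
  pideal :> set R;
  pideal0 : pideal 0;
  pidealD : forall a b, pideal a -> pideal b -> pideal (a + b);
  pidealM : forall a b, pideal b -> pideal (a * b);
  pideal1 : ~ pideal 1;
  pidealP : forall a b, pideal (a * b) -> pideal a \/ pideal b }.

HB.instance Definition _ R := gen_eqMixin (prime_ideal R).
HB.instance Definition _ R := gen_choiceMixin (prime_ideal R).

Section Spec.
Variable R : comPzRingType.

Definition basic_open (f : R) : set (prime_ideal R) := [set p | ~ p f].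

Definition zariski_open (A : set (prime_ideal R)) :=
  forall p, A p -> exists2 f, basic_open f p & basic_open f `<=` A.

Lemma zariski_openT : zariski_open setT.
Proof. by move=> p _; exists 1 => //; exact: pideal1. Qed.

Lemma basic_openM (f g : R) :
  basic_open (f * g) = basic_open f `&` basic_open g.
Proof.
apply/seteqP; split=> [p /= pfg|p [/= pf pg] /pidealP[]//].
split=> h; apply: pfg; last exact: pidealM.
by rewrite mulrC; exact: pidealM.
Qed.

Lemma zariski_openI : setI_closed zariski_open.
Proof.
move=> A B oA oB p [/oA[f pf fA] /oB[g pg gB]].
exists (f * g); rewrite basic_openM; first by [].
by move=> q [/fA ? /gB ?].
Qed.

Lemma zariski_open_bigU (I : Type) (f : I -> set (prime_ideal R)) :
  (forall i, zariski_open (f i)) -> zariski_open (\bigcup_i f i).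
Proof.
move=> of_ p [i _ /of_[g pg gi]]; exists g => // q /gi fq.
by exists i.
Qed.

HB.instance Definition _ := isOpenTopological.Build (prime_ideal R)
  zariski_openT zariski_openI zariski_open_bigU.

Definition spec_top : topologicalType := prime_ideal R.

Lemma compl_prime1 (p : prime_ideal R) : (~` p) 1.
Proof. exact: pideal1. Qed.

Lemma compl_primeM (p : prime_ideal R) s t : (~` p) s -> (~` p) t -> (~` p) (s * t).
Proof. by move=> ps pt /pidealP[]. Qed.

Definition compl_prime (p : prime_ideal R) : mult_set R :=
  MultSet (@compl_prime1 p) (@compl_primeM p).

Definition loc_at (p : prime_ideal R) : comPzRingType :=
  localization (compl_prime p).

Section Sections.
Variable U : opens spec_top.

Definition locally_fraction (s : forall p : spec_top, U p -> loc_at p) :=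
  forall p : spec_top, U p -> exists (V : opens spec_top) (a b : R),
    [/\ V p, V `<=` U &
     forall (q : spec_top) (Uq : U q), V q ->
       exists qb : compl_prime q b, s q Uq = mkfrac a qb].

Record spec_sec := SpecSec {
  ssec :> forall p : spec_top, U p -> loc_at p;
  ssecP : locally_fraction ssec }.

Lemma spec_sec_eq (s t : spec_sec) : (forall p Up, s p Up = t p Up) -> s = t.
Proof.
case: s t => [s hs] [t ht] /= st.
have e : s = t.
  by do 2 (apply: functional_extensionality_dep => ?); exact: st.
by case: _ / e ht => ht; congr SpecSec; exact: Prop_irrelevance.
Qed.

HB.instance Definition _ := gen_eqMixin spec_sec.
HB.instance Definition _ := gen_choiceMixin spec_sec.

Lemma ssec_constP (c : R) :
  locally_fraction (fun p _ => mkfrac c (mset1 (compl_prime p))).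
Proof.
move=> p Up; exists U, c, 1; split=> // q Uq _.
by exists (mset1 (compl_prime q)).
Qed.

Lemma ssec_oppP (s : spec_sec) : locally_fraction (fun p Up => - s p Up).
Proof.
move=> p /(ssecP s)[V [a [b [Vp VU sV]]]].
exists V, (- a), b; split=> // q Uq /(sV q Uq)[qb ->]; exists qb.
exact: loc_oppE.
Qed.

Lemma ssec_op2P (op : forall p, loc_at p -> loc_at p -> loc_at p)
    (num : R -> R -> R -> R -> R) (s t : spec_sec) :
  (forall p a b (pa : compl_prime p a) (pb : compl_prime p b) x y,
    op p (mkfrac x pa) (mkfrac y pb) = mkfrac (num x a y b) (msetM pa pb)) ->
  locally_fraction (fun p Up => op p (s p Up) (t p Up)).
Proof.
move=> opE p Up; have [V [a [b [Vp VU sV]]]] := ssecP s Up.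
have [W [c [d [Wp WU tW]]]] := ssecP t Up.
exists (Opens (openI (openP V) (openP W))), (num a b c d), (b * d).
split=> [//|q [/VU]//|q Uq [Vq Wq]].
have [qb ->] := sV q Uq Vq; have [qd ->] := tW q Uq Wq.
by exists (msetM qb qd); rewrite opE.
Qed.

Lemma ssec_addP (s t : spec_sec) :
  locally_fraction (fun p Up => s p Up + t p Up).
Proof.
apply: (ssec_op2P (op := fun p x y => x + y)
                  (num := fun x a y b => x * b + y * a)).
by move=> p a b pa pb x y; exact: loc_addE.
Qed.

Lemma ssec_mulP (s t : spec_sec) :
  locally_fraction (fun p Up => s p Up * t p Up).
Proof.
apply: (ssec_op2P (op := fun p x y => x * y) (num := fun x a y b => x * y)).
by move=> p a b pa pb x y; exact: loc_mulE.
Qed.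

Definition ssec_add s t := SpecSec (ssec_addP s t).
Definition ssec_mul s t := SpecSec (ssec_mulP s t).
Definition ssec_opp s := SpecSec (ssec_oppP s).
Definition ssec_const c := SpecSec (ssec_constP c).

Lemma ssec_addA : associative ssec_add.
Proof. by move=> s t u; apply: spec_sec_eq => p Up; exact: addrA. Qed.
Lemma ssec_addC : commutative ssec_add.
Proof. by move=> s t; apply: spec_sec_eq => p Up; exact: addrC. Qed.
Lemma ssec_add0 : left_id (ssec_const 0) ssec_add.
Proof. by move=> s; apply: spec_sec_eq => p Up; exact: add0r. Qed.
Lemma ssec_addN : left_inverse (ssec_const 0) ssec_opp ssec_add.
Proof. by move=> s; apply: spec_sec_eq => p Up; exact: addNr. Qed.
Lemma ssec_mulA : associative ssec_mul.
Proof. by move=> s t u; apply: spec_sec_eq => p Up; exact: mulrA. Qed.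
Lemma ssec_mulC : commutative ssec_mul.
Proof. by move=> s t; apply: spec_sec_eq => p Up; exact: mulrC. Qed.
Lemma ssec_mul1 : left_id (ssec_const 1) ssec_mul.
Proof. by move=> s; apply: spec_sec_eq => p Up; exact: mul1r. Qed.
Lemma ssec_mulD : left_distributive ssec_mul ssec_add.
Proof. by move=> s t u; apply: spec_sec_eq => p Up; exact: mulrDl. Qed.

HB.instance Definition _ :=
  GRing.isZmodule.Build spec_sec ssec_addA ssec_addC ssec_add0 ssec_addN.
HB.instance Definition _ :=
  GRing.Zmodule_isComPzRing.Build spec_sec ssec_mulA ssec_mulC ssec_mul1
    ssec_mulD.

End Sections.

Section Restriction.
Variables (U V : opens spec_top) (VU : V `<=` U).

Lemma ssec_resP (s : spec_sec U) :
  locally_fraction (fun p (Vp : V p) => s p (VU Vp)).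
Proof.
move=> p Vp; have [W [a [b [Wp WU sW]]]] := ssecP s (VU Vp).
exists (Opens (openI (openP V) (openP W))), a, b.
by split=> [//|q []//|q Vq [_ /sW]]; exact.
Qed.

Definition ssec_res (s : spec_sec U) : spec_sec V := SpecSec (ssec_resP s).

Lemma ssec_res_zmod : zmod_morphism ssec_res.
Proof. by move=> s t; apply: spec_sec_eq. Qed.
Lemma ssec_res_monoid : monoid_morphism ssec_res.
Proof. by split=> [|s t]; apply: spec_sec_eq. Qed.

HB.instance Definition _ :=
  GRing.isZmodMorphism.Build (spec_sec U) (spec_sec V) ssec_res ssec_res_zmod.
HB.instance Definition _ :=
  GRing.isMonoidMorphism.Build (spec_sec U) (spec_sec V) ssec_res
    ssec_res_monoid.

End Restriction.

Lemma spec_presheaf : is_presheaf ssec_res.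
Proof.
split=> [U h s|U V W h k l s]; apply: spec_sec_eq => p Up /=;
  by congr (ssec s _); exact: Prop_irrelevance.
Qed.

Lemma spec_sheaf : is_sheaf ssec_res.
Proof.
move=> I U V VU UV s sP.
have Vp_ (p : spec_top) (Up : U p) : {i | V i p}.
  by apply: cid; have [i _ Vip] := UV p Up; exists i.
have sE i j (p : spec_top) (ip : V i p) (jp : V j p) : s i p ip = s j p jp.
  pose W : opens spec_top := Opens (openI (openP (V i)) (openP (V j))).
  have e := sP i j W (@subIsetl _ _ _) (@subIsetr _ _ _).
  have := congr1 (fun f : spec_sec W => f p (conj ip jp)) e.
  by rewrite /= (Prop_irrelevance (subIsetl _) ip) (Prop_irrelevance (subIsetr _) jp).
pose t (p : spec_top) (Up : U p) := s (sval (Vp_ p Up)) p (svalP (Vp_ p Up)).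
have tP : locally_fraction t.
  move=> p Up; have [i ip] := Vp_ p Up.
  have [W [a [b [Wp WV sW]]]] := ssecP (s i) ip.
  exists W, a, b; split=> // [q /WV/VU//|q Uq Wq].
  have [qb e] := sW q (WV q Wq) Wq; exists qb.
  by rewrite -e; exact: sE.
exists (SpecSec tP); split=> [i|t' t'P].
  by apply: spec_sec_eq => p Vp; exact: sE.
apply: spec_sec_eq => p Up /=; rewrite /t -t'P /=.
by congr (ssec t' _); exact: Prop_irrelevance.
Qed.

Definition Spec : ringed_space :=
  @RingedSpace spec_top (fun U => spec_sec U)
    (fun U V h => ssec_res h : {rmorphism spec_sec U -> spec_sec V})
    spec_presheaf spec_sheaf.

End Spec.

(** An isomorphism of ringed spaces onto an open subspace. *)
Definition open_immersion (X Y : ringed_space) (j : ringed_mor X Y) :=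
  [/\ injective j,
      forall U : opens X, open (j @` U) &
      forall W : opens Y, W `<=` range j -> bijective (rm_sharp j W)].

Record scheme := Scheme {
  scheme_rs :> ringed_space;
  scheme_local : locally_ringed scheme_rs;
  scheme_affine : forall x : scheme_rs,
    exists (R : comPzRingType) (j : ringed_mor (Spec R) scheme_rs),
      open_immersion j /\ range j x }.

Record scheme_mor (X Y : scheme) := SchemeMor {
  sm_mor :> ringed_mor X Y;
  sm_local : forall (x : X) (V : opens Y) (s : Osec V), V (sm_mor x) ->
    germ_unit (rm_sharp sm_mor V s) x -> germ_unit s (sm_mor x) }.

Section Modules.
Variable X : ringed_space.

Record omod := OMod {
  Msec :> forall U : opens X, lmodType (Osec U);
  Mres : forall U V : opens X, V `<=` U -> Msec U -> Msec V;
  MresD : forall (U V : opens X) (h : V `<=` U) s t, Mres h (s + t) = Mres h s + Mres h t;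
  MresZ : forall (U V : opens X) (h : V `<=` U) (a : Osec U) s,
    Mres h (a *: s) = Ores h a *: Mres h s;
  Mres_presheaf : is_presheaf (F := Msec) Mres;
  Mres_sheaf : is_sheaf (F := Msec) Mres }.

Record omod_hom (M N : omod) := OModHom {
  oh_fun :> forall U : opens X, M U -> N U;
  oh_D : forall U s t, @oh_fun U (s + t) = @oh_fun U s + @oh_fun U t;
  oh_Z : forall U (a : Osec U) s, @oh_fun U (a *: s) = a *: @oh_fun U s;
  oh_res : forall (U V : opens X) (h : V `<=` U) s,
    @oh_fun V (Mres h s) = Mres h (@oh_fun U s) }.

(** [M] restricted to some open neighbourhood of [x] is isomorphic to the free
    module of rank [r]: it has a basis [e]. *)
Definition free_near (M : omod) (r : nat) (x : X) :=
  exists (U : opens X) (e : 'I_r -> M U), U x /\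
    forall (V : opens X) (h : V `<=` U) (s : M V),
      exists! a : 'I_r -> Osec V, s = \sum_(j < r) a j *: Mres h (e j).

(** Only finite ranks occur: subsheaves of a free module of finite rank with
    locally free quotient, and these quotients, have locally finite rank. *)
Definition locally_free (M : omod) := forall x : X, exists r, free_near M r x.

Definition locally_free_of_rank (r : nat) (M : omod) :=
  forall x : X, free_near M r x.

Record submodule (M : omod) := SubModule {
  sub_sec :> forall U : opens X, set (M U);
  sub_0 : forall U, @sub_sec U 0;
  sub_D : forall U s t, @sub_sec U s -> @sub_sec U t -> @sub_sec U (s + t);
  sub_Z : forall U (a : Osec U) s, @sub_sec U s -> @sub_sec U (a *: s);
  sub_res : forall (U V : opens X) (h : V `<=` U) s, @sub_sec U s -> @sub_sec V (Mres h s);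
  sub_local : forall (U : opens X) (s : M U),
    (forall x, U x -> exists (V : opens X) (h : V `<=` U),
       V x /\ @sub_sec V (Mres h s)) -> @sub_sec U s }.

Section SubModuleSheaf.
Variables (M : omod) (E : submodule M).

Record sub_elt (U : opens X) := SubElt { sub_val : M U; sub_valP : E U sub_val }.

Section Lmodule.
Variable U : opens X.
Local Notation T := (sub_elt U).

Lemma sub_val_inj : injective (@sub_val U).
Proof.
move=> [s sE] [t tE] /= e; case: _ / e tE => tE.
by congr SubElt; exact: Prop_irrelevance.
Qed.

HB.instance Definition _ := gen_eqMixin T.
HB.instance Definition _ := gen_choiceMixin T.

Lemma sub_oppP (s : T) : E U (- sub_val s).
Proof. by rewrite -scaleN1r; apply/sub_Z/sub_valP. Qed.

Definition sub_zero : T := SubElt (sub_0 E U).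
Definition sub_opp (s : T) : T := SubElt (sub_oppP s).
Definition sub_add (s t : T) : T := SubElt (sub_D (sub_valP s) (sub_valP t)).
Definition sub_scale (a : Osec U) (s : T) : T := SubElt (sub_Z a (sub_valP s)).

Lemma sub_addA : associative sub_add.
Proof. by move=> s t u; apply: sub_val_inj; exact: addrA. Qed.
Lemma sub_addC : commutative sub_add.
Proof. by move=> s t; apply: sub_val_inj; exact: addrC. Qed.
Lemma sub_add0 : left_id sub_zero sub_add.
Proof. by move=> s; apply: sub_val_inj; exact: add0r. Qed.
Lemma sub_addN : left_inverse sub_zero sub_opp sub_add.
Proof. by move=> s; apply: sub_val_inj; exact: addNr. Qed.

HB.instance Definition _ :=
  GRing.isZmodule.Build T sub_addA sub_addC sub_add0 sub_addN.

Lemma sub_scaleA a b s : sub_scale a (sub_scale b s) = sub_scale (a * b) s.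
Proof. by apply: sub_val_inj; exact: scalerA. Qed.
Lemma sub_scale1 : left_id 1 sub_scale.
Proof. by move=> s; apply: sub_val_inj; exact: scale1r. Qed.
Lemma sub_scaleDr : right_distributive sub_scale +%R.
Proof. by move=> a s t; apply: sub_val_inj; exact: scalerDr. Qed.
Lemma sub_scaleDl s : {morph sub_scale^~ s : a b / a + b}.
Proof. by move=> a b; apply: sub_val_inj; exact: scalerDl. Qed.

HB.instance Definition _ := GRing.Zmodule_isLmodule.Build (Osec U) T
  sub_scaleA sub_scale1 sub_scaleDr sub_scaleDl.

End Lmodule.

Definition sub_elt_res (U V : opens X) (h : V `<=` U) (s : sub_elt U) :
  sub_elt V := SubElt (sub_res h (sub_valP s)).

Lemma sub_elt_resD (U V : opens X) (h : V `<=` U) s t :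
  sub_elt_res h (s + t) = sub_elt_res h s + sub_elt_res h t.
Proof. by apply: sub_val_inj; exact: MresD. Qed.

Lemma sub_elt_resZ (U V : opens X) (h : V `<=` U) (a : Osec U) s :
  sub_elt_res h (a *: s) = Ores h a *: sub_elt_res h s.
Proof. by apply: sub_val_inj; exact: MresZ. Qed.

Lemma sub_elt_presheaf : is_presheaf sub_elt_res.
Proof.
have [res1 resM] := Mres_presheaf M.
by split=> [U h s|U V W h k l s]; apply: sub_val_inj;
  [exact: res1 | exact: resM].
Qed.

Lemma sub_elt_sheaf : is_sheaf sub_elt_res.
Proof.
move=> I U V VU UV s sP.
have [|t [tP tU]] := Mres_sheaf VU UV (s := fun i => sub_val (s i)).
  by move=> i j W Wi Wj; exact: (congr1 (@sub_val W) (sP i j W Wi Wj)).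
have tE : E U t.
  apply: sub_local => x /UV[i _ Vix]; exists (V i), (VU i).
  by rewrite tP; split=> //; exact: sub_valP.
exists (SubElt tE); split=> [i|t' t'P]; apply: sub_val_inj; first exact: tP.
by apply: tU => i; exact: (congr1 (@sub_val (V i)) (t'P i)).
Qed.

Definition sub_omod : omod :=
  @OMod (fun U => sub_elt U) sub_elt_res sub_elt_resD sub_elt_resZ
    sub_elt_presheaf sub_elt_sheaf.

(** [pi] exhibits [Q] as the quotient sheaf [M / E]: it is an epimorphism of
    sheaves (locally surjective) with kernel [E]. *)
Definition is_quotient (Q : omod) (pi : omod_hom M Q) :=
  (forall U s, pi U s = 0 <-> E U s) /\
  (forall U (q : Q U) x, U x -> exists (V : opens X) (h : V `<=` U) (s : M V),
     V x /\ pi V s = Mres h q).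

Definition locally_free_quotient :=
  exists (Q : omod) (pi : omod_hom M Q), is_quotient pi /\ locally_free Q.

End SubModuleSheaf.

Section Matrices.
Variables m n : nat.

Definition mx_res (U V : opens X) (h : V `<=` U) :
  'M[Osec U]_(m, n) -> 'M[Osec V]_(m, n) := map_mx (Ores h).

Lemma mx_resD (U V : opens X) (h : V `<=` U) s t :
  mx_res h (s + t) = mx_res h s + mx_res h t.
Proof. exact: map_mxD. Qed.

Lemma mx_resZ (U V : opens X) (h : V `<=` U) a s : mx_res h (a *: s) = Ores h a *: mx_res h s.
Proof. exact: map_mxZ. Qed.

Lemma mx_presheaf : is_presheaf mx_res.
Proof.
have [res1 resM] := Ores_presheaf X.
by split=> [U h s|U V W h k l s]; apply/matrixP=> i j; rewrite !mxE;
  [exact: res1 | exact: resM].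
Qed.

Lemma mx_sheaf : is_sheaf mx_res.
Proof.
move=> I U V VU UV s sP.
have H i j : {t : Osec U | (forall k, Ores (VU k) t = s k i j) /\
    forall t', (forall k, Ores (VU k) t' = s k i j) -> t = t'}.
  apply: cid; have [|t [tP tU]] := Ores_sheaf VU UV (s := fun k => s k i j).
    move=> k l W Wk Wl.
    have := congr1 (fun A : 'M__ => A i j) (sP k l W Wk Wl).
    by rewrite !mxE.
  by exists t.
exists (\matrix_(i, j) sval (H i j)); split=> [k|t' t'P].
  by apply/matrixP=> i j; rewrite !mxE; case: (H i j) => /= t [].
apply/matrixP=> i j; rewrite !mxE; case: (H i j) => /= t [_]; apply=> k.
by rewrite -t'P mxE.
Qed.

Definition mx_omod : omod :=
  @OMod (fun U => 'M[Osec U]_(m, n)) mx_res mx_resD mx_resZ mx_presheaf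
    mx_sheaf.

End Matrices.
End Modules.

Arguments mx_omod : clear implicits.

(** An additive map from [E] to the direct image of [F], linear over the
    structure morphism of [f]. *)
Record omod_fmap (X Y : ringed_space) (f : ringed_mor X Y)
    (E : omod Y) (F : omod X) := OModFMap {
  of_fun :> forall V : opens Y, E V -> F (preim_opens (rm_cont f) V);
  of_D : forall V s t, @of_fun V (s + t) = @of_fun V s + @of_fun V t;
  of_Z : forall V (a : Osec V) s,
    @of_fun V (a *: s) = rm_sharp f V a *: @of_fun V s;
  of_res : forall (V W : opens Y) (h : W `<=` V)
    (k : preim_opens (rm_cont f) W `<=` preim_opens (rm_cont f) V) s,
    @of_fun W (Mres h s) = Mres k (@of_fun V s) }.

(** [phi] exhibits [F] as the inverse image of [E] under [f]: it is a universal
    arrow from [E] to the direct image functor. *)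
Definition is_inverse_image (X Y : ringed_space) (f : ringed_mor X Y)
    (E : omod Y) (F : omod X) (phi : omod_fmap f E F) :=
  forall (N : omod X) (psi : omod_fmap f E N),
    exists! theta : omod_hom F N,
      forall (V : opens Y) (s : E V), theta _ (phi V s) = psi V s.

(** The inverse image of [E] is [F], compatibly with the identification of the
    inverse image of the free module on [Y] with the free module on [X]. *)
Definition is_inverse_image_sub (X Y : ringed_space) (f : ringed_mor X Y)
    (m n : nat) (E : submodule (mx_omod Y m n)) (F : submodule (mx_omod X m n)) :=
  exists phi : omod_fmap f (sub_omod E) (sub_omod F),
    (forall (V : opens Y) (s : sub_omod E V),
       sub_val (phi V s) = map_mx (rm_sharp f V) (sub_val s)) /\
    is_inverse_image phi.

Definition mx_inverse (R : comPzRingType) (n : nat) (P Q : 'M[R]_n) :=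
  P *m Q = 1%:M /\ Q *m P = 1%:M.

Section Molds.
Variables (X : ringed_space) (n : nat).
Local Notation Mn := (mx_omod X n n).

Definition subalgebra (A : submodule Mn) :=
  forall U : opens X, A U 1%:M /\ forall a b, A U a -> A U b -> A U (a *m b).

Definition mold (A : submodule Mn) :=
  [/\ subalgebra A, locally_free (sub_omod A) & locally_free_quotient A].

Definition locally_equivalent (A B : submodule Mn) :=
  forall x : X, exists (U : opens X) (P Q : 'M[Osec U]_n),
    [/\ U x, mx_inverse P Q &
     forall (V : opens X) (h : V `<=` U),
       [set mx_res h Q *m a *m mx_res h P | a in A V] = B V].

Definition upper_tri (U : opens X) : set 'M[Osec U]_n :=
  [set a | forall i j : 'I_n, (j < i)%N -> a i j = 0].

Lemma upper_tri0 U : upper_tri (0 : 'M[Osec U]_n).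
Proof. by move=> i j _; rewrite mxE. Qed.

Lemma upper_triD U (a b : 'M[Osec U]_n) :
  upper_tri a -> upper_tri b -> upper_tri (a + b).
Proof. by move=> ha hb i j ij; rewrite mxE ha ?hb ?addr0. Qed.

Lemma upper_triZ U (c : Osec U) (a : 'M[Osec U]_n) :
  upper_tri a -> upper_tri (c *: a).
Proof. by move=> ha i j ij; rewrite mxE ha ?mulr0. Qed.

Lemma upper_tri_res (U V : opens X) (h : V `<=` U) (a : 'M[Osec U]_n) :
  upper_tri a -> upper_tri (mx_res h a).
Proof. by move=> ha i j ij; rewrite mxE ha ?rmorph0. Qed.

Lemma upper_tri_local (U : opens X) (a : 'M[Osec U]_n) :
  (forall x, U x -> exists (V : opens X) (h : V `<=` U),
     V x /\ upper_tri (mx_res h a)) -> upper_tri a.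
Proof.
move=> ha i j ij.
pose I := {V : opens X | exists h : V `<=` U, upper_tri (mx_res h a)}.
pose VU (k : I) : sval k `<=` U := projT1 (cid (svalP k)).
have UV : U `<=` \bigcup_(k : I) sval k.
  by move=> x /ha[V [h [Vx Va]]]; exists (exist _ V (ex_intro _ h Va)).
have a0 k : Ores (VU k) (a i j) = 0.
  by rewrite /VU; case: cid => h /= /(_ i j ij); rewrite mxE.
have [|t [_ tU]] := Ores_sheaf VU UV (s := fun=> 0).
  by move=> k l W Wk Wl; rewrite !rmorph0.
by rewrite -(tU _ a0); apply: tU => k; rewrite rmorph0.
Qed.

(** The base change to the structure sheaf of the algebra of integral upper
    triangular matrices. That algebra is spanned by the elementary matrices
    [E_ij] with [i <= j], so the sections of its base change are the upper
    triangular matrices with coefficients in the sections. *)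
Definition borel : submodule Mn :=
  @SubModule X Mn upper_tri upper_tri0 upper_triD upper_triZ upper_tri_res
    upper_tri_local.

Definition borel_mold (A : submodule Mn) := mold A /\ locally_equivalent A borel.

End Molds.

(** Degree [n] representations are group morphisms to GL_n for a group, monoid
    morphisms to M_n for a monoid. *)

Variant group_or_monoid := IsGroup of groupType | IsMonoid of monoidType.

Definition gm_monoid (Gamma : group_or_monoid) : monoidType :=
  match Gamma with IsGroup G => G | IsMonoid M => M end.
Coercion gm_monoid : group_or_monoid >-> Monoid.type.

Definition gm_group (Gamma : group_or_monoid) : bool :=
  if Gamma is IsGroup _ then true else false.

Section Representations.
Variables (Gamma : group_or_monoid) (n : nat) (X : ringed_space).

Record representation := Representation {
  rep_fun :> Gamma -> 'M[Osec (opensT X)]_n;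
  rep_1 : rep_fun 1%g = 1%:M;
  rep_M : forall g h : Gamma, rep_fun (g * h)%g = rep_fun g *m rep_fun h;
  rep_GL : gm_group Gamma -> forall g, exists Q, mx_inverse (rep_fun g) Q }.

Variable rho : representation.

Definition rep_res (U : opens X) (g : Gamma) : 'M[Osec U]_n :=
  mx_res (subsetT U : U `<=` opensT X) (rho g).

Definition contains_rep (A : submodule (mx_omod X n n)) :=
  forall (g : Gamma) (U : opens X), A U (rep_res U g).

Definition rep_algebra_sec (U : opens X) : set 'M[Osec U]_n :=
  [set a | forall A : submodule (mx_omod X n n),
     subalgebra A -> contains_rep A -> A U a].

Lemma rep_algebra0 U : rep_algebra_sec (0 : 'M[Osec U]_n).
Proof. by move=> A _ _; exact: (sub_0 A U). Qed.

Lemma rep_algebraD U (a b : 'M[Osec U]_n) :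
  rep_algebra_sec a -> rep_algebra_sec b -> rep_algebra_sec (a + b).
Proof. by move=> ha hb A h1 h2; apply: (@sub_D _ _ A); [exact: ha | exact: hb]. Qed.

Lemma rep_algebraZ U (c : Osec U) (a : 'M[Osec U]_n) :
  rep_algebra_sec a -> rep_algebra_sec (c *: a).
Proof. by move=> ha A h1 h2; apply: (@sub_Z _ _ A); exact: ha. Qed.

Lemma rep_algebra_res (U V : opens X) (h : V `<=` U) (a : 'M[Osec U]_n) :
  rep_algebra_sec a -> rep_algebra_sec (mx_res h a).
Proof. by move=> ha A h1 h2; apply: (@sub_res _ _ A); exact: ha. Qed.

Lemma rep_algebra_local (U : opens X) (a : 'M[Osec U]_n) :
  (forall x, U x -> exists (V : opens X) (h : V `<=` U),
     V x /\ rep_algebra_sec (mx_res h a)) -> rep_algebra_sec a.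
Proof.
move=> ha A h1 h2; apply: (@sub_local _ _ A) => x /ha[V [h [Vx Va]]].
by exists V, h; split=> //; exact: Va.
Qed.

Definition rep_algebra : submodule (mx_omod X n n) :=
  @SubModule X (mx_omod X n n) rep_algebra_sec rep_algebra0 rep_algebraD
    rep_algebraZ rep_algebra_res rep_algebra_local.

Definition has_borel_mold := borel_mold rep_algebra.

(** Sections of the free module of rank [n] are column vectors. *)
Definition subbundle (r : nat) (E : submodule (mx_omod X n 1)) :=
  locally_free_of_rank r (sub_omod E) /\ locally_free_quotient E.

Definition invariant (E : submodule (mx_omod X n 1)) :=
  forall (g : Gamma) (U : opens X) v, E U v -> E U (rep_res U g *m v).

Definition invariant_subbundle (r : nat) (E : submodule (mx_omod X n 1)) :=
  subbundle r E /\ invariant E.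

(** A complete flag is indexed by its proper terms: [E i] has rank [i + 1]. *)
Definition invariant_flag (E : 'I_n.-1 -> submodule (mx_omod X n 1)) :=
  (forall i : 'I_n.-1, invariant_subbundle i.+1 (E i)) /\
  (forall (i j : 'I_n.-1) (U : opens X), (i <= j)%N -> E i U `<=` E j U).

End Representations.

Definition pullback (Gamma : group_or_monoid) (n : nat) (X Y : ringed_space)
  (f : ringed_mor X Y) (sigma : representation Gamma n Y) (g : Gamma) :
  'M[Osec (opensT X)]_n :=
  mx_res (fun x _ => I : preim_opens (rm_cont f) (opensT Y) x)
    (map_mx (rm_sharp f (opensT Y)) (sigma g)).

(** [(B, sigma)] represents the functor of degree [n] representations with Borel
    mold, [sigma] being the universal representation. *)
Definition represents_borel (Gamma : group_or_monoid) (n : nat) (B : scheme)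
    (sigma : representation Gamma n B) :=
  has_borel_mold sigma /\
  forall (X : scheme) (rho : representation Gamma n X), has_borel_mold rho ->
    exists! f : scheme_mor X B, forall g, pullback f sigma g = rho g.

(* Main.v *)
(** Locally the algebra generated by the representation is [P T Q], with [T] the
    upper triangular matrices and [Q] inverse to [P], and the subbundle of rank
    [k] is the image of the idempotent [P pi_k Q], where [pi_k] projects onto the
    first [k] coordinates. Two such pairs differ by a matrix normalizing [T], and
    such a matrix is upper triangular, so these images glue.

    Conversely an invariant subbundle is locally the kernel of an idempotent [p]
    such that, after conjugation, [p E_ij (1 - p) = 0] for [i <= j]. Its diagonal
    entries are then idempotents, which are 0 or 1 near a point of a locally
    ringed space, and this forces the kernel of [p] to be the image of some
    [pi_k]; comparing ranks determines [k].

    The pairs [(P, Q)] of the universal representation pull back to such pairs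
    for [rho], so the two subbundles are locally the images of [e] and of its
    pullback. A morphism out of the former thus extends by
    [v = sum_j v_j (col j e)]. *)

From HB Require Import structures.
Require Import Defs.
From mathcomp Require Import all_boot all_algebra.
From mathcomp Require Import boolp classical_sets filter topology.

Set Implicit Arguments.
Unset Strict Implicit.
Unset Printing Implicit Defensive.

Import GRing.Theory.
Local Open Scope classical_set_scope.
Local Open Scope ring_scope.

(** * Upper triangular matrices *)

Section UpperTriangular.
Variables (R : comPzRingType) (n : nat).
Implicit Types (t p G H : 'M[R]_n) (k : nat).

Definition upper_triangular t := forall i j : 'I_n, (j < i)%N -> t i j = 0.

Lemma pid_mx_mulE k m (A : 'M[R]_(n, m)) i j :
  ((pid_mx k : 'M_n) *m A) i j = if (i < k)%N then A i j else 0.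
Proof.
rewrite mxE (bigD1 i) //= mxE eqxx big1 ?addr0 => [|l li].
  by case: ifP => _; rewrite ?mul1r ?mul0r.
by rewrite mxE eq_sym -val_eqE in li *; rewrite (negbTE li) mul0r.
Qed.

Lemma mul_pid_mxE k m (A : 'M[R]_(m, n)) i j :
  (A *m (pid_mx k : 'M_n)) i j = if (j < k)%N then A i j else 0.
Proof.
rewrite mxE (bigD1 j) //= mxE eqxx big1 ?addr0 => [|l lj].
  by case: ifP => _; rewrite ?mulr1 ?mulr0.
by rewrite mxE -val_eqE in lj *; rewrite (negbTE lj) mulr0.
Qed.

Lemma pid_mx_idem k : (pid_mx k : 'M[R]_n) *m pid_mx k = (pid_mx k : 'M_n).
Proof.
by apply/matrixP=> i j; rewrite pid_mx_mulE !mxE; case: ltnP; rewrite ?andbF.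
Qed.

Lemma pid_mx_absorb k l : (k <= l)%N ->
  (pid_mx l : 'M[R]_n) *m pid_mx k = (pid_mx k : 'M_n).
Proof.
move=> kl; apply/matrixP=> i j; rewrite pid_mx_mulE !mxE.
case: (ltnP i k) => ik; last by rewrite andbF if_same.
by rewrite (leq_trans ik kl).
Qed.

(** The span of the first [k] basis vectors is stable under [t], and [pid_mx k] acts on it as the
    identity. *)
Lemma upper_triangular_pid t k : upper_triangular t ->
  (pid_mx k : 'M_n) *m t *m pid_mx k = t *m (pid_mx k : 'M_n).
Proof.
move=> ut; apply/matrixP=> i j; rewrite !mul_pid_mxE pid_mx_mulE.
case: ifP => // jk; case: ltnP => // ki.
by apply/esym/ut/(leq_trans jk).
Qed.

Lemma upper_triangular_delta (i j : 'I_n) :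
  (i <= j)%N -> upper_triangular (delta_mx i j).
Proof.
move=> ij a b ba; rewrite mxE; case: andP => // -[/eqP ai /eqP bj].
by move: ba; rewrite ai bj ltnNge ij.
Qed.

Lemma mul_mx_delta_mx m q (A : 'M[R]_(m, n)) (B : 'M[R]_(n, q)) i j a b :
  (A *m delta_mx i j *m B) a b = A a i * B j b.
Proof.
rewrite mxE (bigD1 j) //= big1 ?addr0 => [|l lj].
  rewrite mxE (bigD1 i) //= big1 ?addr0 => [|l li]; first by rewrite mxE !eqxx mulr1.
  by rewrite mxE (negbTE li) mulr0.
by rewrite mxE big1 ?mul0r // => i' _; rewrite mxE (negbTE lj) andbF mulr0.
Qed.

(* In [G a b = sum_c G a b * G b c * H c b], the terms with [b <= c] vanish since
   [G E_bc H] is upper triangular, those with [c < b] by induction on [b]. *)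
Lemma normalizer_upper_triangular G H :
  G *m H = 1%:M -> H *m G = 1%:M ->
  (forall t, upper_triangular t -> upper_triangular (G *m t *m H)) ->
  upper_triangular G.
Proof.
move=> GH HG norm.
have key (a b c d : 'I_n) : (b <= c)%N -> (d < a)%N -> G a b * H c d = 0.
  move=> bc da; rewrite -mul_mx_delta_mx.
  exact/norm/da/upper_triangular_delta.
suff ind m : forall a b : 'I_n, (b < m)%N -> (b < a)%N -> G a b = 0.
  by move=> a b; apply: (ind b.+1).
elim: m => // m IH a b bm ba.
have : (G *m H) b b = 1 by rewrite GH mxE eqxx.
move=> /(congr1 (fun x => G a b * x)); rewrite mulr1 => <-.
rewrite mxE big_distrr big1 // => c _ /=.
case: (ltnP c b) => cb.
  by rewrite (IH b c) ?mul0r ?mulr0 // (leq_trans cb).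
by rewrite mulrCA key ?mulr0.
Qed.

(** Entrywise the hypothesis reads [p a i * ((j == b)%:R - p j b) = 0] for [i <= j]. Hence a
    diagonal entry 1 forces all later ones to be 1, and [k] is the index where the ones begin. A
    diagonal entry 0 kills its column of [p], and a diagonal entry 1 kills its row of [1 - p]. *)
Lemma idempotent_kernel p :
  (forall i j : 'I_n, (i <= j)%N -> p *m delta_mx i j *m (1%:M - p) = 0) ->
  (forall j, p j j = 0 \/ p j j = 1) ->
  exists k, [/\ (k <= n)%N, p *m (pid_mx k : 'M_n) = 0 &
    (pid_mx k : 'M_n) *m (1%:M - p) = 1%:M - p].
Proof.
move=> inv p01.
have key (a b i j : 'I_n) : (i <= j)%N -> p a i * ((j == b)%:R - p j b) = 0.
  move=> /inv/(congr1 (fun A : 'M__ => A a b)).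
  by rewrite mul_mx_delta_mx !mxE.
have up (i j : 'I_n) : (i <= j)%N -> p i i = 1 -> p j j = 1.
  move=> ij pi; have := key i j i j ij.
  by rewrite pi eqxx mul1r => /eqP; rewrite subr_eq0 => /eqP.
pose P k := `[< forall j : 'I_n, (k <= j)%N -> p j j = 1 >].
have exP : exists k, P k.
  by exists n; apply/asboolP => j; rewrite leqNgt ltn_ord.
case: (ex_minnP exP) => k /asboolP Pk kmin.
have p0 (j : 'I_n) : (j < k)%N -> p j j = 0.
  move=> jk; case: (p01 j) => // pj; exfalso.
  move: jk; rewrite ltnNge => /negP; apply.
  by apply: kmin; apply/asboolP => i ji; apply: up pj.
exists k; split.
- by apply: kmin; apply/asboolP => j; rewrite leqNgt ltn_ord.
- apply/matrixP=> a j; rewrite mul_pid_mxE mxE; case: ifP => // /p0 pj.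
  by have := key a j j j (leqnn j); rewrite pj eqxx subr0 mulr1.
- apply/matrixP=> j b; rewrite pid_mx_mulE; case: ltnP => // /Pk pj.
  by have := key j b j j (leqnn j); rewrite pj mul1r !mxE.
Qed.

End UpperTriangular.

(** If [n < m], cut [A] and [B] after index [n]. The leading square blocks are inverse to each other
    on both sides, so the remaining block of [B] vanishes, although its product with the remaining
    block of [A] is a nonempty identity matrix. *)
Lemma mulmx1_leq (R : comPzRingType) m n (A : 'M[R]_(m, n)) (B : 'M[R]_(n, m)) :
  (1 : R) <> 0 -> A *m B = 1%:M -> (m <= n)%N.
Proof.
move=> nz AB; rewrite leqNgt; apply/negP=> /subnKC; rewrite addSnnS.
move: (_ - _)%N => k def_m; move: AB; rewrite -{m}def_m in A B *.
rewrite -(vsubmxK A) -(hsubmxK B) mul_col_row scalar_mx_block.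
case/eq_block_mx=> /mulmx1C BA AB0 _ AB1; apply: nz.
have := congr1 (fun C : 'M__ => C ord0 ord0) AB1.
by rewrite -[rsubmx B]mul1mx -BA -mulmxA AB0 !mulmx0 !mxE => /esym.
Qed.
Lemma mulmx_sum_col (R : comPzRingType) m n (A : 'M[R]_(m, n)) (w : 'cV[R]_n) :
  A *m w = \sum_j w j 0 *: col j A.
Proof.
apply/colP=> i; rewrite mxE summxE; apply: eq_bigr => j _.
by rewrite !mxE mulrC.
Qed.

(** * Sections and restrictions *)

Definition opensI (X : topologicalType) (U V : opens X) : opens X :=
  Opens (openI (openP U) (openP V)).

Lemma opensIl (X : topologicalType) (U V : opens X) : opensI U V `<=` U.
Proof. exact: subIsetl. Qed.

Lemma opensIr (X : topologicalType) (U V : opens X) : opensI U V `<=` V.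
Proof. exact: subIsetr. Qed.

Arguments opensIl {X} U V.
Arguments opensIr {X} U V.

Section Restriction.
Variable X : ringed_space.
Implicit Types U V W : opens X.

Lemma Ores_res U V W (h : V `<=` U) (k : W `<=` V) (l : W `<=` U) (a : Osec U) :
  Ores k (Ores h a) = Ores l a.
Proof. exact: (Ores_presheaf X).2. Qed.

Lemma mx_res_res m n U V W (h : V `<=` U) (k : W `<=` V) (l : W `<=` U)
  (A : 'M[Osec U]_(m, n)) : mx_res k (mx_res h A) = mx_res l A.
Proof. exact: (mx_presheaf X m n).2. Qed.

Lemma mx_res_refl m n U (h : U `<=` U) (A : 'M[Osec U]_(m, n)) : mx_res h A = A.
Proof. exact: (mx_presheaf X m n).1. Qed.

Lemma mx_resM m n p U V (h : V `<=` U) (A : 'M[Osec U]_(m, n))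
  (B : 'M[Osec U]_(n, p)) : mx_res h (A *m B) = mx_res h A *m mx_res h B.
Proof. exact: map_mxM. Qed.

Lemma mx_resB m n U V (h : V `<=` U) (A B : 'M[Osec U]_(m, n)) :
  mx_res h (A - B) = mx_res h A - mx_res h B.
Proof. exact: map_mxB. Qed.

Lemma mx_res1 n U V (h : V `<=` U) : mx_res h (1%:M : 'M[Osec U]_n) = 1%:M.
Proof. exact: map_mx1. Qed.

Lemma mx_res0 m n U V (h : V `<=` U) : mx_res h (0 : 'M[Osec U]_(m, n)) = 0.
Proof. exact: map_mx0. Qed.

Lemma mx_res_pid m n k U V (h : V `<=` U) :
  mx_res h (pid_mx k : 'M[Osec U]_(m, n)) = pid_mx k.
Proof. exact: map_pid_mx. Qed.

Lemma mx_res_col m n U V (h : V `<=` U) (A : 'M[Osec U]_(m, n)) j :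
  mx_res h (col j A) = col j (mx_res h A).
Proof. exact: map_col. Qed.

Definition mx_resE := (mx_resM, mx_resB, mx_res1, mx_res0, mx_res_pid).

Section Modules.
Variable M : omod X.

Lemma Mres_res U V W (h : V `<=` U) (k : W `<=` V) (l : W `<=` U) (s : M U) :
  Mres k (Mres h s) = Mres l s.
Proof. exact: (Mres_presheaf M).2. Qed.

Lemma Mres_refl U (h : U `<=` U) (s : M U) : Mres h s = s.
Proof. exact: (Mres_presheaf M).1. Qed.

(** Both sections glue the restrictions of [t] to the opens on which the two agree. *)
Lemma Mres_separated U (s t : M U) :
  (forall x, U x -> exists V (h : V `<=` U), V x /\ Mres h s = Mres h t) -> s = t.
Proof.
move=> st; pose I := {V : opens X | exists h : V `<=` U, Mres h s = Mres h t}.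
pose VU (k : I) : sval k `<=` U := projT1 (cid (svalP k)).
have UV : U `<=` \bigcup_(k : I) sval k.
  by move=> x /st[V [h [Vx e]]]; exists (exist _ V (ex_intro _ h e)).
have [|r [_ ru]] := Mres_sheaf VU UV (s := fun k => Mres (VU k) t).
  by move=> k l W Wk Wl; rewrite !(Mres_res _ _ (subset_trans Wk (VU k))).
rewrite -(ru t) // -[LHS]ru // => k.
by rewrite /VU; case: cid.
Qed.

Lemma Mres0 U V (h : V `<=` U) : Mres h (0 : M U) = 0.
Proof. by rewrite -[0 in LHS](scale0r 0) MresZ rmorph0 scale0r. Qed.

Lemma Mres_sum U V (h : V `<=` U) (I : finType) (F : I -> M U) :
  Mres h (\sum_i F i) = \sum_i Mres h (F i).
Proof. by apply: (big_morph _ (MresD h) (Mres0 h)). Qed.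

Lemma sub_sum (E : submodule M) U (I : finType) (F : I -> M U) :
  (forall i, E U (F i)) -> E U (\sum_i F i).
Proof.
move=> EF; apply: (big_ind (E U)) => // [|s t]; first exact: sub_0.
exact: sub_D.
Qed.

Lemma submodule_ext (E F : submodule M) :
  (forall U s, E U s <-> F U s) -> E = F.
Proof.
case: E F => [E E0 ED EZ Er El] [F F0 FD FZ Fr Fl] /= EF.
have e : E = F.
  by apply: functional_extensionality_dep => U; apply/funext => s; apply/propext.
case: _ / e F0 FD FZ Fr Fl {EF} => *.
by congr SubModule; exact: Prop_irrelevance.
Qed.

Lemma submodule_local_ext (E F : submodule M) :
  (forall x : X, exists V, V x /\
     forall W (h : W `<=` V) (s : M W), E W s <-> F W s) -> E = F.
Proof.
move=> loc; apply: submodule_ext => U s.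
suff H (G G' : submodule M) : (forall x : X, exists V, V x /\
     forall W (h : W `<=` V) (s : M W), G W s <-> G' W s) -> G U s -> G' U s.
  split; first exact: H.
  by apply: H => x; have [V [Vx e]] := loc x; exists V; split=> // W h t; rewrite e.
move=> {}loc Gs; apply: sub_local => x Ux.
have [V [Vx e]] := loc x; exists (opensI U V), (opensIl U V); split=> //.
by apply/e; [exact: opensIr | exact: sub_res].
Qed.

End Modules.

Section Homs.
Variables (M N : omod X) (phi : omod_hom M N).

Lemma oh_0 U : phi U 0 = 0.
Proof. by rewrite -[0 in LHS](scale0r 0) oh_Z scale0r. Qed.

Lemma oh_sum U (I : finType) (F : I -> M U) :
  phi U (\sum_i F i) = \sum_i phi U (F i).
Proof. by apply: (big_morph (phi U)); [exact: oh_D | exact: oh_0]. Qed.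

Lemma oh_B U s t : phi U (s - t) = phi U s - phi U t.
Proof. by rewrite -scaleN1r oh_D oh_Z scaleN1r. Qed.

End Homs.

(** Finitely many local conditions that survive shrinking hold together on the intersection of their
    neighbourhoods. *)
Lemma open_nbhs_forall (I : finType) (x : X) (U : opens X)
    (P : I -> opens X -> Prop) : U x ->
  (forall i V W, W `<=` V -> P i V -> P i W) ->
  (forall i, exists V, V x /\ P i V) ->
  exists V, [/\ V x, V `<=` U & forall i, P i V].
Proof.
move=> Ux Pmono /choice[F FP].
have : nbhs x [set y | forall i, F i y].
  apply: filter_forall => i; apply: open_nbhs_nbhs.
  by split; [exact: openP | case: (FP i)].
rewrite nbhsE => -[A [oA Ax] AF].
exists (opensI U (Opens oA)); split=> [//||i]; first exact: opensIl.
by apply: (Pmono i (F i)); [move=> y [_ /AF]; apply | case: (FP i)].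
Qed.

End Restriction.

(** * Products of direct images of restrictions to opens *)

Section ProductSheaf.
Variables (X : ringed_space) (I : Type) (D : I -> opens X) (M : omod X).
Implicit Types U V W : opens X.

Section Sections.
Variable U : opens X.

(** The factor at [i] is the direct image on [X] of the restriction of [M] to [D i]. *)
Definition prod_sec := forall i, M (opensI U (D i)).

HB.instance Definition _ := gen_eqMixin prod_sec.
HB.instance Definition _ := gen_choiceMixin prod_sec.

Definition prod_add (s t : prod_sec) : prod_sec := fun i => s i + t i.
Definition prod_opp (s : prod_sec) : prod_sec := fun i => - s i.
Definition prod_zero : prod_sec := fun i => 0.
Definition prod_scale (a : Osec U) (s : prod_sec) : prod_sec :=
  fun i => Ores (opensIl U (D i)) a *: s i.

Local Ltac pointwise := apply: functional_extensionality_dep => ?.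

Lemma prod_addA : associative prod_add.
Proof. by move=> s t u; pointwise; exact: addrA. Qed.
Lemma prod_addC : commutative prod_add.
Proof. by move=> s t; pointwise; exact: addrC. Qed.
Lemma prod_add0 : left_id prod_zero prod_add.
Proof. by move=> s; pointwise; exact: add0r. Qed.
Lemma prod_addN : left_inverse prod_zero prod_opp prod_add.
Proof. by move=> s; pointwise; exact: addNr. Qed.

HB.instance Definition _ :=
  GRing.isZmodule.Build prod_sec prod_addA prod_addC prod_add0 prod_addN.

Lemma prod_scaleA a b s : prod_scale a (prod_scale b s) = prod_scale (a * b) s.
Proof. by pointwise; rewrite /prod_scale scalerA rmorphM. Qed.
Lemma prod_scale1 : left_id 1 prod_scale.
Proof. by move=> s; pointwise; rewrite /prod_scale rmorph1 scale1r. Qed.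
Lemma prod_scaleDr : right_distributive prod_scale +%R.
Proof. by move=> a s t; pointwise; exact: scalerDr. Qed.
Lemma prod_scaleDl s : {morph prod_scale^~ s : a b / a + b}.
Proof. by move=> a b; pointwise; rewrite /prod_scale rmorphD; exact: scalerDl. Qed.

HB.instance Definition _ := GRing.Zmodule_isLmodule.Build (Osec U) prod_sec
  prod_scaleA prod_scale1 prod_scaleDr prod_scaleDl.

End Sections.

Definition prod_res U V (h : V `<=` U) (s : prod_sec U) : prod_sec V :=
  fun i => Mres (setSI h : opensI V (D i) `<=` opensI U (D i)) (s i).

Lemma prod_resD U V (h : V `<=` U) s t :
  prod_res h (s + t) = prod_res h s + prod_res h t.
Proof. by apply: functional_extensionality_dep => i; exact: MresD. Qed.

Lemma prod_resZ U V (h : V `<=` U) (a : Osec U) s :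
  prod_res h (a *: s) = Ores h a *: prod_res h s.
Proof.
apply: functional_extensionality_dep => i; rewrite /prod_res MresZ; congr (_ *: _).
have k : opensI V (D i) `<=` U by move=> x [/h].
by rewrite !(Ores_res _ _ k).
Qed.

Lemma prod_presheaf : is_presheaf prod_res.
Proof.
split=> [U h s|U V W h k l s]; apply: functional_extensionality_dep => i.
  exact: Mres_refl.
exact: Mres_res.
Qed.

Lemma prod_sheaf : is_sheaf prod_res.
Proof.
move=> J U V VU UV s sP.
have H i : exists! t : M (opensI U (D i)), forall k,
    Mres (setSI (VU k) : opensI (V k) (D i) `<=` opensI U (D i)) t = s k i.
  apply: Mres_sheaf => [x [/UV[k _ Vx] Dx]|k l W Wk Wl]; first by exists k.
  (* Components of the given family live over opens intersected with [D i], so the agreement is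
     taken over the intersection of [V k] and [V l] and then restricted to [W]. *)
  have WV : W `<=` opensI (opensI (V k) (V l)) (D i).
    by move=> x Wx; have [? ?] := Wk x Wx; have [? ?] := Wl x Wx.
  have := sP k l (opensI (V k) (V l)) (opensIl _ _) (opensIr _ _).
  move=> /(congr1 (fun t => Mres WV (t i))).
  by rewrite /prod_res !(Mres_res _ _ Wk) !(Mres_res _ _ Wl).
exists (fun i => sval (cid (H i))); split=> [k|t' t'P].
  by apply: functional_extensionality_dep => i; exact: (svalP (cid (H i))).1.
apply: functional_extensionality_dep => i.
by apply: (svalP (cid (H i))).2 => k; rewrite -t'P.
Qed.

Definition prod_omod : omod X :=
  @OMod X (fun U => prod_sec U) prod_res prod_resD prod_resZ prod_presheaf
    prod_sheaf.

End ProductSheaf.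

(** * The image subsheaf of a morphism of modules *)

Section Image.
Variables (X : ringed_space) (M N : omod X) (phi : omod_hom M N).
Implicit Types U V W : opens X.

Definition image_sec U : set (N U) := [set t | forall x, U x ->
  exists V (h : V `<=` U) (s : M V), V x /\ phi V s = Mres h t].

Lemma image_sec_phi U s : image_sec (phi U s).
Proof.
by move=> x Ux; exists U, (@subset_refl _ U), s; rewrite Mres_refl.
Qed.

Lemma image_sec0 U : image_sec (0 : N U).
Proof. by rewrite -(oh_0 phi); exact: image_sec_phi. Qed.

Lemma image_secD U (s t : N U) : image_sec s -> image_sec t -> image_sec (s + t).
Proof.
move=> hs ht x Ux; have [V [h [a [Vx ea]]]] := hs x Ux.
have [W [k [b [Wx eb]]]] := ht x Ux.
have VW : opensI V W `<=` V := opensIl V W.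
have WV : opensI V W `<=` W := opensIr V W.
exists (opensI V W), (subset_trans VW h), (Mres VW a + Mres WV b); split=> //.
by rewrite oh_D !oh_res ea eb MresD !(Mres_res _ _ (subset_trans VW h)).
Qed.

Lemma image_secZ U (c : Osec U) (s : N U) : image_sec s -> image_sec (c *: s).
Proof.
move=> hs x Ux; have [V [h [a [Vx ea]]]] := hs x Ux.
by exists V, h, (Ores h c *: a); rewrite oh_Z ea MresZ.
Qed.

Lemma image_sec_res U V (h : V `<=` U) (s : N U) :
  image_sec s -> image_sec (Mres h s).
Proof.
move=> hs x Vx; have [W [k [a [Wx ea]]]] := hs x (h x Vx).
have WV : opensI W V `<=` V := opensIr W V.
have VW : opensI W V `<=` W := opensIl W V.
exists (opensI W V), WV, (Mres VW a); split=> //.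
by rewrite oh_res ea !(Mres_res _ _ (subset_trans VW k)).
Qed.

Lemma image_sec_local U (s : N U) :
  (forall x, U x -> exists V (h : V `<=` U), V x /\ image_sec (Mres h s)) ->
  image_sec s.
Proof.
move=> loc x Ux; have [V [h [Vx hs]]] := loc x Ux.
have [W [k [a [Wx ea]]]] := hs x Vx.
exists W, (subset_trans k h), a; split=> //.
by rewrite ea (Mres_res _ _ (subset_trans k h)).
Qed.

Definition image_sub : submodule N :=
  @SubModule X N image_sec image_sec0 image_secD image_secZ image_sec_res
    image_sec_local.

Definition corestrict_fun U (s : M U) : sub_omod image_sub U :=
  SubElt (image_sec_phi s : image_sub U (phi U s)).

Lemma corestrictD U (s t : M U) :
  corestrict_fun (s + t) = corestrict_fun s + corestrict_fun t.
Proof. by apply: sub_val_inj; exact: oh_D. Qed.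

Lemma corestrictZ U (a : Osec U) (s : M U) :
  corestrict_fun (a *: s) = a *: corestrict_fun s.
Proof. by apply: sub_val_inj; exact: oh_Z. Qed.

Lemma corestrict_res U V (h : V `<=` U) (s : M U) :
  corestrict_fun (Mres h s) = Mres h (corestrict_fun s).
Proof. by apply: sub_val_inj; exact: oh_res. Qed.

Definition corestrict : omod_hom M (sub_omod image_sub) :=
  OModHom corestrictD corestrictZ corestrict_res.

(** Local surjectivity is built into the sections of the image, so only the kernel has to be
    identified. *)
Lemma corestrict_quotient (E : submodule M) :
  (forall U s, phi U s = 0 <-> E U s) -> is_quotient E corestrict.
Proof.
move=> ker; split=> [U s|U [q qim] x Ux].
  by rewrite -ker; split=> [/(congr1 (@sub_val _ _ _ _))|/= e]; last exact: sub_val_inj.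
have [V [h [s [Vx e]]]] := qim x Ux.
by exists V, h, s; split=> //; exact: sub_val_inj.
Qed.

End Image.
(** * Subsheaves cut out by an idempotent *)

Section Splitting.
Variables (X : ringed_space) (n : nat).
Implicit Types (U V W : opens X) (E : submodule (mx_omod X n 1)).

(** As [e] is idempotent, being fixed by [e] amounts to lying in its image: over [V], [e] is a
    projector of the free module onto [E]. *)
Definition splits E V (e : 'M[Osec V]_n) :=
  e *m e = e /\ forall W (h : W `<=` V) (v : 'cV[Osec W]_n),
    E W v <-> mx_res h e *m v = v.

Lemma splits_res E V W (h : W `<=` V) (e : 'M[Osec V]_n) :
  splits E e -> splits E (mx_res h e).
Proof.
move=> [ee Ee]; split=> [|Z k v]; first by rewrite -mx_resM ee.
by rewrite (mx_res_res h k (subset_trans k h)).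
Qed.

Lemma splits_cols E V (e : 'M[Osec V]_n) m (A : 'M[Osec V]_(n, m)) :
  splits E e -> (e *m A = A <-> forall j, E V (col j A)).
Proof.
move=> [_ Ee]; split=> [eA j|EA].
  by apply/(Ee V (@subset_refl _ V)); rewrite mx_res_refl !colE mulmxA eA.
apply/matrixP=> i j; have /(Ee V (@subset_refl _ V)) := EA j.
rewrite mx_res_refl !colE mulmxA -!colE.
by move=> /(congr1 (fun w : 'cV__ => w i 0)); rewrite ![col _ _ _ _]mxE.
Qed.

Lemma splits_local_ext E F :
  (forall x : X, exists V (e : 'M[Osec V]_n), [/\ V x, splits E e & splits F e]) ->
  E = F.
Proof.
move=> loc; apply: submodule_local_ext => x.
have [V [e [Vx [_ Ee] [_ Fe]]]] := loc x.
by exists V; split=> // W h v; rewrite (Ee W h) (Fe W h).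
Qed.

Lemma sub_val_sum E U (I : finType) (F : I -> sub_elt E U) :
  sub_val (\sum_i F i) = \sum_i sub_val (F i).
Proof. by apply: (big_morph (@sub_val _ _ E U)). Qed.

Section Free.
Variables (x : X) (E : submodule (mx_omod X n 1)) (V : opens X) (Vx : V x).
Variables (e : 'M[Osec V]_n) (Ee : splits E e).
Variables (s : nat) (C : 'M[Osec V]_(n, s)) (D : 'M[Osec V]_(s, n)).
Hypothesis DC : D *m C = 1%:M.

Lemma mx_res_DC W (h : W `<=` V) m (a : 'M[Osec W]_(s, m)) :
  mx_res h D *m (mx_res h C *m a) = a.
Proof. by rewrite mulmxA -mx_resM DC mx_res1 mul1mx. Qed.

Lemma mulmx_col_res W (h : W `<=` V) (a : 'I_s -> Osec W) :
  \sum_j a j *: mx_res h (col j C) = mx_res h C *m \col_j a j.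
Proof. by rewrite mulmx_sum_col; apply: eq_bigr => j _; rewrite mxE mx_res_col. Qed.

(** The columns of [C] form a basis of the image of [e], and [D] computes the coordinates. *)
Lemma splits_free_near : e = C *m D -> free_near (sub_omod E) s x.
Proof.
move=> eCD; have EC : forall j, E V (col j C).
  by apply/(splits_cols C Ee); rewrite eCD -mulmxA DC mulmx1.
exists V, (fun j => (SubElt (EC j) : sub_omod E V)); split=> // W h [v Ev].
have ev : mx_res h C *m (mx_res h D *m v) = v.
  by rewrite mulmxA -mx_resM -eCD; apply/(Ee.2 W h).
have sumE (a : 'I_s -> Osec W) :
    sub_val (\sum_j a j *: Mres h (SubElt (EC j) : sub_omod E V)) =
    mx_res h C *m \col_j a j.
  by rewrite sub_val_sum /= mulmx_col_res.
exists (fun j => (mx_res h D *m v) j 0); split=> [|a ea].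
  apply: sub_val_inj; rewrite sumE /= -[LHS]ev; congr (_ *m _).
  by apply/colP=> j; rewrite [RHS]mxE.
apply: funext => j; have -> : v = mx_res h C *m \col_j a j.
  by rewrite -sumE -ea.
by rewrite mx_res_DC mxE.
Qed.

(** On a common neighbourhood of [x], the given basis and the columns of [C] are related by matrices
    [M] and [N] that are inverse to each other, and over a nonzero ring such matrices are square. *)
Lemma splits_rank r : e = C *m D ->
  (forall W, W x -> (1 : Osec W) <> 0) -> free_near (sub_omod E) r x -> r = s.
Proof.
move=> eCD nz [U [b [Ux bP]]]; pose W := opensI U V.
have hU : W `<=` U := opensIl U V; have hV : W `<=` V := opensIr U V.
pose B : 'M[Osec W]_(n, r) := \matrix_(i, j) mx_res hU (sub_val (b j)) i 0.
have colB j : col j B = mx_res hU (sub_val (b j)).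
  by apply/colP=> i; rewrite !mxE.
have EB j : E W (col j B) by rewrite colB; exact: sub_res (sub_valP (b j)).
have sumE (a : 'I_r -> Osec W) :
    sub_val (\sum_j a j *: Mres hU (b j)) = B *m \col_j a j.
  rewrite sub_val_sum /= mulmx_sum_col; apply: eq_bigr => j _.
  by rewrite mxE colB.
have eB : mx_res hV e *m B = B by apply/(splits_cols B (splits_res hV Ee)).
have EC j : E W (col j (mx_res hV C)).
  move: j; apply/(splits_cols _ (splits_res hV Ee)).
  by rewrite -mx_resM eCD -mulmxA DC mulmx1.
have coord j : {a : 'I_r -> Osec W | B *m \col_i a i = col j (mx_res hV C)}.
  apply: cid; have [a [ea _]] := bP W hU (SubElt (EC j)).
  by exists a; rewrite -sumE -ea.
pose M : 'M[Osec W]_(r, s) := \matrix_(i, j) sval (coord j) i.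
have BM : B *m M = mx_res hV C.
  apply/matrixP=> i j; have := svalP (coord j).
  move=> /(congr1 (fun w : 'cV__ => w i 0)); rewrite [RHS]mxE => <-.
  by rewrite !mxE; apply: eq_bigr => k _; rewrite !mxE.
pose N := mx_res hV D *m B.
have NM : N *m M = 1%:M by rewrite -mulmxA BM -mx_resM DC mx_res1.
have BMN : B *m (M *m N) = B by rewrite mulmxA BM mulmxA -mx_resM -eCD.
(* Uniqueness of coordinates in the basis allows cancelling [B] in [B *m (M *m N) = B], one column
   at a time. *)
have MN : M *m N = 1%:M.
  apply/matrixP=> i j; have [a [_ au]] := bP W hU (Mres hU (b j)).
  have col_uniq (A : 'M[Osec W]_r) : B *m A = B -> a = A^~ j.
    move=> BA; apply: au; apply: sub_val_inj; rewrite sumE /= -colB -{1}BA.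
    by rewrite !colE -mulmxA; congr (_ *m _); apply/colP=> k; rewrite -colE !mxE.
  by have := col_uniq _ BMN; rewrite (col_uniq _ (mulmx1 B)) => /(congr1 (@^~ i)).
have nzW := nz W (conj Ux Vx).
by apply/eqP; rewrite eqn_leq (mulmx1_leq nzW MN) (mulmx1_leq nzW NM).
Qed.

End Free.

Record split_chart E := SplitChart {
  sc_open : opens X; sc_mx : 'M[Osec sc_open]_n; sc_splits : splits E sc_mx }.

(* The quotient by [E] is realized without sheafification, as the image of the
   maps [1 - e] on all charts, inside a product of direct images. *)
Section Quotient.
Variable E : submodule (mx_omod X n 1).
Local Notation N := (prod_omod (@sc_open E) (mx_omod X n 1)).

Definition cosplit_fun U (v : 'cV[Osec U]_n) : N U :=
  fun c => (1%:M - mx_res (opensIr U (sc_open c)) (sc_mx c)) *m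
    mx_res (opensIl U (sc_open c)) v.

Lemma cosplitD U (v w : 'cV[Osec U]_n) :
  cosplit_fun (v + w) = cosplit_fun v + cosplit_fun w.
Proof.
apply: functional_extensionality_dep => c.
by rewrite /cosplit_fun mx_resD mulmxDr.
Qed.

Lemma cosplitZ U (a : Osec U) (v : 'cV[Osec U]_n) :
  cosplit_fun (a *: v) = a *: cosplit_fun v.
Proof.
apply: functional_extensionality_dep => c.
by rewrite /cosplit_fun mx_resZ -scalemxAr.
Qed.

Lemma cosplit_res U W (h : W `<=` U) (v : 'cV[Osec U]_n) :
  cosplit_fun (mx_res h v) = Mres h (cosplit_fun v).
Proof.
apply: functional_extensionality_dep => c; rewrite /cosplit_fun /= /prod_res /=.
have kU : opensI W (sc_open c) `<=` U by move=> y [/h].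
have kV : opensI W (sc_open c) `<=` sc_open c := opensIr W (sc_open c).
rewrite !mx_resE !(mx_res_res _ _ kU) !(mx_res_res _ _ kV).
by rewrite (Prop_irrelevance kV (opensIr _ _)).
Qed.

Definition cosplit : omod_hom (mx_omod X n 1) N :=
  @OModHom X (mx_omod X n 1) N cosplit_fun cosplitD cosplitZ cosplit_res.

Hypothesis E_split : forall x : X, exists V (e : 'M[Osec V]_n), V x /\ splits E e.

(** The component at a chart vanishes exactly when the idempotent of that chart fixes [v], and the
    charts cover [X] by [E_split]. *)
Lemma cosplit_kernel U v : cosplit U v = 0 <-> E U v.
Proof.
split=> [v0|Ev].
  apply: sub_local => x Ux; have [V [e [Vx Ee]]] := E_split x.
  exists (opensI U V), (opensIl U V); split=> //.
  have [_] := Ee.2 _ (opensIr U V) (mx_res (opensIl U V) v); apply.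
  apply/esym/eqP; rewrite -subr_eq0.
  have := congr1 (fun t : N U => t (SplitChart Ee)) v0.
  by rewrite /= /cosplit_fun /= mulmxBl mul1mx => ->.
apply: functional_extensionality_dep => c; rewrite /= /cosplit_fun.
rewrite mulmxBl mul1mx; apply/eqP; rewrite subr_eq0; apply/eqP/esym.
have [H _] := (sc_splits c).2 _ (opensIr U _) (mx_res (opensIl U _) v).
by apply: H; exact: sub_res Ev.
Qed.

Lemma cosplit_fun_res U (Z : opens X) (c : split_chart E) (ZU : Z `<=` U)
    (ZV : Z `<=` sc_open c) (ZI : Z `<=` opensI U (sc_open c)) (v : 'cV_n) :
  mx_res ZI (cosplit U v c) = (1%:M - mx_res ZV (sc_mx c)) *m mx_res ZU v.
Proof.
by rewrite /= /cosplit_fun !mx_resE !(mx_res_res _ _ ZV) (mx_res_res _ _ ZU).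
Qed.

(** The images of the columns of [C] form a basis. The coordinates of a section are obtained by
    applying [D] to its component at the single chart given by [e]. *)
Lemma cosplit_free_near x V (e : 'M[Osec V]_n) s (C : 'M[Osec V]_(n, s))
    (D : 'M[Osec V]_(s, n)) :
  V x -> splits E e -> D *m C = 1%:M -> 1%:M - e = C *m D ->
  free_near (sub_omod (image_sub cosplit)) s x.
Proof.
move=> Vx Ee DC eCD; pose pi := corestrict cosplit; pose c := SplitChart Ee.
exists V, (fun j => pi V (col j C)); split=> // W h q.
have sumE (a : 'I_s -> Osec W) :
    \sum_j a j *: Mres h (pi V (col j C)) = pi W (mx_res h C *m \col_j a j).
  rewrite -mulmx_col_res oh_sum; apply: eq_bigr => j _.
  by rewrite oh_Z oh_res.
have WV : W `<=` opensI W V by move=> y Wy; split=> //; exact: (h y).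
pose w : 'cV_n := mx_res WV (sub_val q c).
have CD (Z : opens X) (l : Z `<=` V) (u : 'cV_n) :
    (1%:M - mx_res l e) *m u = mx_res l C *m (mx_res l D *m u).
  by rewrite mulmxA -mx_resM -eCD mx_resB mx_res1.
exists (fun j => (mx_res h D *m w) j 0); split=> [|a qa]; last first.
  apply: funext => j; rewrite /w qa sumE /=.
  rewrite (cosplit_fun_res (c := c) (@subset_refl _ W) h) mx_res_refl CD.
  by rewrite !(mx_res_DC DC) mxE.
rewrite sumE; have -> : \col_j (mx_res h D *m w) j 0 = mx_res h D *m w.
  by apply/colP=> j; rewrite mxE.
apply: (Mres_separated (M := sub_omod (image_sub cosplit))) => y Wy.
have [Z [k [v [Zy ev]]]] := sub_valP q y Wy; exists Z, k; split=> //.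
have ZV : Z `<=` V := subset_trans k h.
have ZI : Z `<=` opensI Z V by move=> z Zz; split=> //; exact: (ZV z).
have ZWV : Z `<=` opensI W V by move=> z /k; exact: (WV z).
have wZ : mx_res k w = (1%:M - mx_res ZV e) *m v.
  rewrite -[v in RHS](mx_res_refl (@subset_refl _ Z)).
  rewrite -(cosplit_fun_res (c := c) _ ZV ZI) ev /= /prod_res /=.
  by rewrite !(mx_res_res _ _ ZWV).
have CDw : mx_res k (mx_res h C *m (mx_res h D *m w)) = (1%:M - mx_res ZV e) *m v.
  by rewrite !mx_resM !(mx_res_res _ _ ZV) wZ CD (mx_res_DC DC).
(* Both sides are now images under [cosplit], of [v] and of [(1 - e) v]. These differ by [e v], a
   section of [E], which [cosplit] kills. *)
apply: sub_val_inj; rewrite -[LHS]ev -[RHS](oh_res cosplit k) [Mres k _]CDw.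
apply/eqP; rewrite -subr_eq0 -oh_B; apply/eqP/cosplit_kernel/(Ee.2 Z ZV).
by rewrite mulmxBl mul1mx opprB addrCA subrr addr0 mulmxA -mx_resM Ee.1.
Qed.

End Quotient.
End Splitting.

(** * Local projectors onto a submodule with locally free quotient *)

Section Subbundle.
Variables (X : ringed_space) (n : nat) (E : submodule (mx_omod X n 1)).
Implicit Types U V W : opens X.

(* A lift [S] of a local basis of the quotient, together with the matrix [a] of
   the projection in that basis, gives the idempotent [1 - S a] onto [E]. *)
Lemma locally_free_quotient_splits (x : X) : locally_free_quotient E ->
  exists V (e : 'M[Osec V]_n), V x /\ splits E e.
Proof.
move=> [N [pi [[ker surj] /(_ x)[r [U [q [Ux qP]]]]]]].
have [|j|V [Vx VU lift]] := @open_nbhs_forall X 'I_r x U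
    (fun j V => exists (h : V `<=` U) (s : 'cV[Osec V]_n), pi V s = Mres h (q j)) Ux.
- move=> j V W k [h [s e]]; exists (subset_trans k h), (mx_res k s).
  by rewrite [LHS](oh_res pi k s) e (Mres_res _ _ (subset_trans k h)).
- have [V [h [s [Vx e]]]] := surj U (q j) x Ux.
  by exists V; split=> //; exists h, s.
have sP j : {s : 'cV[Osec V]_n | pi V s = Mres VU (q j)}.
  by apply: cid; have [h [s e]] := lift j; exists s; rewrite (Prop_irrelevance VU h).
have bP k : {b : 'I_r -> Osec V |
    pi V (delta_mx k 0 : 'cV_n) = \sum_j b j *: Mres VU (q j)}.
  by apply: cid; have [b [e _]] := qP V VU (pi V (delta_mx k 0 : 'cV_n)); exists b.
pose S : 'M[Osec V]_(n, r) := \matrix_(i, j) sval (sP j) i 0.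
pose a : 'M[Osec V]_(r, n) := \matrix_(j, k) sval (bP k) j.
have piE W (h : W `<=` V) (l : W `<=` U) (v : 'cV[Osec W]_n) :
    pi W v = \sum_j (mx_res h a *m v) j 0 *: Mres l (q j).
  have piD k : pi W (delta_mx k 0) = \sum_j mx_res h a j k *: Mres l (q j).
    rewrite -(map_delta_mx (Ores h)) [LHS](oh_res pi h) (svalP (bP k)) Mres_sum.
    by apply: eq_bigr => j _; rewrite MresZ (Mres_res _ _ l) !mxE.
  transitivity (\sum_k v k 0 *: pi W (delta_mx k 0)).
    rewrite [v in LHS]matrix_sum_delta oh_sum; apply: eq_bigr => k _.
    by rewrite big_ord1 oh_Z.
  rewrite (eq_bigr _ (fun k _ => congr1 _ (piD k))).
  rewrite (eq_bigr _ (fun k _ => scaler_sumr _ _ _ _)) exchange_big.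
  apply: eq_bigr => j _; rewrite [mulmx _ _ _ _]mxE scaler_suml.
  by apply: eq_bigr => k _; rewrite scalerA mulrC.
(* Column [j] of either matrix gives the coordinates of [q j], and coordinates are unique. *)
have aS : a *m S = 1%:M.
  apply/matrixP=> i j; have [b [_ bu]] := qP V VU (Mres VU (q j)).
  have e1 : b = (a *m S)^~ j.
    apply: bu; rewrite -(svalP (sP j)) (piE V (@subset_refl _ V) VU) mx_res_refl.
    apply: eq_bigr => l _; congr (_ *: _).
    by rewrite !mxE; apply: eq_bigr => k _; rewrite !mxE.
  have e2 : b = (1%:M : 'M_r)^~ j.
    apply: bu; rewrite (bigD1 j) //= mxE eqxx scale1r big1 ?addr0 // => l lj.
    by rewrite mxE (negbTE lj) scale0r.
  by move: e1; rewrite e2 => /(congr1 (@^~ i)).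
exists V, (1%:M - S *m a); split=> //; split=> [|W h v].
  rewrite mulmxBl mul1mx !mulmxBr mulmx1 -mulmxA [a *m (S *m a)]mulmxA aS mul1mx.
  by rewrite subrr subr0.
pose l := subset_trans h VU; rewrite -ker (piE W h l) !mx_resE mulmxBl mul1mx.
(* A combination of the basis [q] vanishes only if its coefficients do, so membership in the kernel
   becomes a matrix equation. *)
have -> : (\sum_j (mx_res h a *m v) j 0 *: Mres l (q j) = 0) <-> mx_res h a *m v = 0.
  split=> [v0|->]; last by rewrite big1 // => j _; rewrite mxE scale0r.
  have [b [_ bu]] := qP W l 0; apply/colP=> j; rewrite [RHS]mxE.
  have e1 := bu _ (esym v0).
  have : b = fun=> 0 by apply: bu; rewrite big1 // => i _; rewrite scale0r.
  by rewrite e1 => /(congr1 (@^~ j)).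
split=> [v0|]; first by rewrite -mulmxA v0 mulmx0 subr0.
rewrite -mulmxA => /(congr1 (mulmx (mx_res h a))).
rewrite mulmxBr [mx_res h a *m (mx_res h S *m _)]mulmxA -mx_resM aS mx_res1 mul1mx.
by rewrite subrr.
Qed.

End Subbundle.

(** * The invariant flag *)

Section BorelChart.
Variables (X : ringed_space) (n : nat) (A : submodule (mx_omod X n n)).
Implicit Types U V W : opens X.

(** Over [V], the sheaf [A] consists of the matrices [P t Q] with [t] upper triangular. *)
Definition borel_chart V (P Q : 'M[Osec V]_n) :=
  mx_inverse P Q /\ forall W (h : W `<=` V) (a : 'M[Osec W]_n),
    A W a <-> upper_triangular (mx_res h Q *m a *m mx_res h P).

Lemma mx_inverse_res U V (h : V `<=` U) (P Q : 'M[Osec U]_n) :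
  mx_inverse P Q -> mx_inverse (mx_res h P) (mx_res h Q).
Proof. by move=> [PQ QP]; rewrite /mx_inverse -!mx_resM PQ QP mx_res1. Qed.

Lemma borel_chart_res V W (h : W `<=` V) (P Q : 'M[Osec V]_n) :
  borel_chart P Q -> borel_chart (mx_res h P) (mx_res h Q).
Proof.
move=> [PQ AP]; split=> [|Z k a]; first exact: mx_inverse_res.
by rewrite !(mx_res_res _ _ (subset_trans k h)).
Qed.

Lemma locally_equivalent_chart : locally_equivalent A (borel X n) ->
  forall x : X, exists V (P Q : 'M[Osec V]_n), V x /\ borel_chart P Q.
Proof.
move=> eqv x; have [V [P [Q [Vx PQ AB]]]] := eqv x.
exists V, P, Q; split=> //; split=> // W h a.
have [PQ' QP'] := mx_inverse_res h PQ.
rewrite -[upper_triangular _]/(borel X n W _) -(AB W h).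
split=> [Aa|[b Ab]]; first by exists a.
move=> /(congr1 (fun c => mx_res h P *m c *m mx_res h Q)).
by rewrite !mulmxA PQ' !mul1mx -!mulmxA PQ' !mulmx1 => <-.
Qed.

Lemma borel_chart_idem k V (P Q : 'M[Osec V]_n) : borel_chart P Q ->
  P *m pid_mx k *m Q *m (P *m pid_mx k *m Q) = P *m pid_mx k *m Q.
Proof.
move=> [[_ QP] _]; rewrite -!mulmxA [Q *m (P *m _)]mulmxA QP mul1mx.
by rewrite [pid_mx k *m (pid_mx k *m _)]mulmxA pid_mx_idem.
Qed.

(** Both charts describe [A], so conjugation by [Q' *m P] preserves upper triangular matrices. Hence
    [Q' *m P] is itself upper triangular and preserves the span of the first [k] basis vectors, so
    the image of the idempotent of one chart lies in that of the other. *)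
Lemma borel_chart_unique k V (P Q P' Q' : 'M[Osec V]_n) :
  borel_chart P Q -> borel_chart P' Q' ->
  P' *m pid_mx k *m Q' *m (P *m pid_mx k *m Q) = P *m pid_mx k *m Q.
Proof.
move=> [[PQ QP] AP] [[PQ' QP'] AP'].
have GH : Q' *m P *m (Q *m P') = 1%:M.
  by rewrite -mulmxA [P *m (Q *m _)]mulmxA PQ mul1mx QP'.
have HG : Q *m P' *m (Q' *m P) = 1%:M.
  by rewrite -mulmxA [P' *m (Q' *m _)]mulmxA PQ' mul1mx QP.
have uG : upper_triangular (Q' *m P).
  apply: normalizer_upper_triangular GH HG _ => t ut.
  have : A V (P *m t *m Q).
    apply/(AP V (@subset_refl _ V)); rewrite !mx_res_refl !mulmxA QP mul1mx.
    by rewrite -mulmxA QP mulmx1.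
  by move=> /(AP' V (@subset_refl _ V)); rewrite !mx_res_refl !mulmxA.
have := upper_triangular_pid k uG => /(congr1 (fun B => P' *m B *m Q)).
by rewrite !mulmxA PQ' mul1mx.
Qed.

Section Flag.
Variable k : nat.

(** Quantifying over all charts of all smaller opens avoids any choice and any gluing; [flag_splits]
    shows that one chart decides membership over it. *)
Definition flag_sec U : set 'cV[Osec U]_n :=
  [set v | forall V (h : V `<=` U) (P Q : 'M[Osec V]_n), borel_chart P Q ->
     P *m pid_mx k *m Q *m mx_res h v = mx_res h v].

Lemma flag_sec0 U : flag_sec (0 : 'cV[Osec U]_n).
Proof. by move=> V h P Q _; rewrite mx_res0 mulmx0. Qed.

Lemma flag_secD U (v w : 'cV[Osec U]_n) :
  flag_sec v -> flag_sec w -> flag_sec (v + w).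
Proof. by move=> hv hw V h P Q PQ; rewrite mx_resD mulmxDr hv ?hw. Qed.

Lemma flag_secZ U (c : Osec U) (v : 'cV[Osec U]_n) :
  flag_sec v -> flag_sec (c *: v).
Proof. by move=> hv V h P Q PQ; rewrite mx_resZ -scalemxAr hv. Qed.

Lemma flag_sec_res U V (h : V `<=` U) (v : 'cV[Osec U]_n) :
  flag_sec v -> flag_sec (mx_res h v).
Proof.
by move=> hv W l P Q PQ; rewrite (mx_res_res h l (subset_trans l h)) hv.
Qed.

Lemma flag_sec_local U (v : 'cV[Osec U]_n) :
  (forall x, U x -> exists V (h : V `<=` U), V x /\ flag_sec (mx_res h v)) ->
  flag_sec v.
Proof.
move=> loc V h P Q PQ.
apply: (Mres_separated (M := mx_omod X n 1)) => x Vx.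
have [W [l [Wx hW]]] := loc x (h x Vx).
exists (opensI V W), (opensIl V W); split=> //=.
have := hW _ (opensIr V W) _ _ (borel_chart_res (opensIl V W) PQ).
have VWU := subset_trans (opensIl V W) h.
by rewrite !mx_resE !(mx_res_res _ _ VWU).
Qed.

Definition flag : submodule (mx_omod X n 1) :=
  @SubModule X (mx_omod X n 1) flag_sec flag_sec0 flag_secD flag_secZ
    flag_sec_res flag_sec_local.

Lemma flag_splits V (P Q : 'M[Osec V]_n) :
  borel_chart P Q -> splits flag (P *m pid_mx k *m Q).
Proof.
move=> PQ; split=> [|W h v]; first exact: borel_chart_idem.
rewrite !mx_resE; split=> [hv|ev Z l P' Q' PQ'].
  have := hv W (@subset_refl _ W) _ _ (borel_chart_res h PQ).
  by rewrite mx_res_refl.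
have ZV := subset_trans l h.
have := congr1 (mx_res l) ev; rewrite !mx_resE !(mx_res_res _ _ ZV) => <-.
by rewrite mulmxA borel_chart_unique //; exact: borel_chart_res.
Qed.

End Flag.
End BorelChart.

(** * Factorizations of [pid_mx k] and of its complement through free modules *)

Lemma copid_mx_factor (R : comPzRingType) n k : (k <= n)%N ->
  exists s (K : 'M[R]_(n, s)) (L : 'M[R]_(s, n)),
    L *m K = 1%:M /\ 1%:M - (pid_mx k : 'M_n) = K *m L.
Proof.
move=> /subnKC <-; exists (n - k)%N, (col_mx 0 1%:M), (row_mx 0 1%:M); split.
  by rewrite mul_row_col mulmx0 add0r mulmx1.
rewrite mul_col_row !mul0mx mulmx0 mulmx1 scalar_mx_block pid_mx_block.
by rewrite opp_block_mx add_block_mx !oppr0 !addr0 subrr.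
Qed.

Lemma pid_mx_factor (R : comPzRingType) n k : (k <= n)%N ->
  (pid_mx k : 'M[R]_(k, n)) *m (pid_mx k : 'M_(n, k)) = 1%:M /\
  (pid_mx k : 'M[R]_(n, k)) *m (pid_mx k : 'M_(k, n)) = (pid_mx k : 'M_n).
Proof.
move=> kn; rewrite !mul_pid_mx !minnn.
by move/minn_idPr: kn => ->; rewrite pid_mx_1.
Qed.

(** * Idempotent sections on a locally ringed space *)

Section LocallyRinged.
Variables (X : ringed_space) (local_X : locally_ringed X) (x : X).
Implicit Types U V W : opens X.

Lemma locally_ringed_nontrivial U : U x -> (1 : Osec U) <> 0.
Proof.
move=> Ux e; have [nz _] := local_X Ux; apply: nz.
by exists U, (@subset_refl _ U), 0; rewrite mulr0.
Qed.

Lemma germ_unit_idempotent U (a : Osec U) : a * a = a -> germ_unit a x ->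
  exists V (h : V `<=` U), V x /\ Ores h a = 1.
Proof.
move=> aa [V [h [t [Vx e]]]]; exists V, h; split=> //.
by rewrite -[LHS]mulr1 -e mulrA -rmorphM aa e.
Qed.

(** Since [a] and [1 - a] sum to 1, one of them is a unit in the local stalk at [x], and an
    idempotent that is a unit equals 1. *)
Lemma idempotent_locally_trivial U (a : Osec U) : U x -> a * a = a ->
  exists V (h : V `<=` U), V x /\ (Ores h a = 0 \/ Ores h a = 1).
Proof.
move=> Ux aa; have [ua|nua] := pselect (germ_unit a x).
  have [V [h [Vx e]]] := germ_unit_idempotent aa ua.
  by exists V, h; split=> //; right.
have [ub|nub] := pselect (germ_unit (1 - a) x).
  have bb : (1 - a) * (1 - a) = 1 - a.
    by rewrite mulrBl mul1r mulrBr mulr1 aa subrr subr0.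
  have [V [h [Vx e]]] := germ_unit_idempotent bb ub.
  exists V, h; split=> //; left.
  by rewrite -[a]opprK -[- a](addKr 1) opprD opprK rmorphD rmorphN e rmorph1 subrr.
have [_ /(_ _ _ nua nub)[]] := local_X Ux.
exists U, (@subset_refl _ U), 1; split=> //.
by rewrite addrCA subrr addr0 rmorph1 mulr1.
Qed.

End LocallyRinged.

(** * The algebra of matrices preserving a submodule *)

Section Stabilizer.
Variables (X : ringed_space) (n : nat) (E : submodule (mx_omod X n 1)).
Implicit Types U V W : opens X.

Definition stab_sec U : set 'M[Osec U]_n :=
  [set a | forall V (h : V `<=` U) (v : 'cV[Osec V]_n),
     E V v -> E V (mx_res h a *m v)].

Lemma stab_sec0 U : stab_sec (0 : 'M[Osec U]_n).
Proof. by move=> V h v _; rewrite mx_res0 mul0mx; exact: (sub_0 E). Qed.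

Lemma stab_secD U (a b : 'M[Osec U]_n) :
  stab_sec a -> stab_sec b -> stab_sec (a + b).
Proof.
move=> ha hb V h v Ev; rewrite mx_resD mulmxDl.
by apply: (@sub_D _ _ E); [exact: ha | exact: hb].
Qed.

Lemma stab_secZ U (c : Osec U) (a : 'M[Osec U]_n) :
  stab_sec a -> stab_sec (c *: a).
Proof.
move=> ha V h v Ev; rewrite mx_resZ -scalemxAl.
by apply: (@sub_Z _ _ E); exact: ha.
Qed.

Lemma stab_sec_res U V (h : V `<=` U) (a : 'M[Osec U]_n) :
  stab_sec a -> stab_sec (mx_res h a).
Proof.
move=> ha W l v Ev; rewrite (mx_res_res h l (subset_trans l h)).
exact: ha.
Qed.

Lemma stab_sec_local U (a : 'M[Osec U]_n) :
  (forall x, U x -> exists V (h : V `<=` U), V x /\ stab_sec (mx_res h a)) ->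
  stab_sec a.
Proof.
move=> loc V h v Ev; apply: (@sub_local _ _ E) => x Vx.
have [W [l [Wx hW]]] := loc x (h x Vx).
exists (opensI V W), (opensIl V W); split=> //.
have := hW _ (opensIr V W) _ (sub_res (opensIl V W) Ev).
have VWU := subset_trans (opensIl V W) h.
by rewrite /= mx_resM !(mx_res_res _ _ VWU).
Qed.

Definition stabilizer : submodule (mx_omod X n n) :=
  @SubModule X (mx_omod X n n) stab_sec stab_sec0 stab_secD stab_secZ
    stab_sec_res stab_sec_local.

Lemma stabilizer_subalgebra : subalgebra stabilizer.
Proof.
move=> U; split=> [V h v Ev|a b ha hb V h v Ev]; first by rewrite mx_res1 mul1mx.
by rewrite mx_resM -mulmxA; apply: ha; exact: hb.
Qed.

End Stabilizer.

(** * Invariant subbundles of a representation with Borel mold *)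

Section Representation.
Variables (Gamma : group_or_monoid) (n : nat) (X : ringed_space).
Variable rho : representation Gamma n X.
Implicit Types (U V W : opens X) (k : nat).

Lemma rep_res_res g U V (h : V `<=` U) : mx_res h (rep_res rho U g) = rep_res rho V g.
Proof. exact: mx_res_res. Qed.

(** The stabilizer of [E] is a subalgebra containing the representation, so it contains the
    generated algebra. *)
Lemma invariant_rep_algebra (E : submodule (mx_omod X n 1)) :
  Defs.invariant rho E -> forall U a v, rep_algebra rho U a -> E U v -> E U (a *m v).
Proof.
move=> invE U a v /(_ (stabilizer E) (stabilizer_subalgebra E)) Sa Ev.
rewrite -(mx_res_refl (@subset_refl _ U) a); apply: Sa Ev => g V W h w Ew.
by rewrite rep_res_res; exact: invE.
Qed.

Lemma rep_algebra_rep g U : rep_algebra rho U (rep_res rho U g).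
Proof. by move=> A _; exact. Qed.

Hypothesis borel_rho : has_borel_mold rho.
Local Notation A := (rep_algebra rho).

Lemma rep_chart (x : X) : exists V (P Q : 'M[Osec V]_n), V x /\ borel_chart A P Q.
Proof. by apply: locally_equivalent_chart; case: borel_rho. Qed.

Lemma flag_locally_split k (x : X) :
  exists V (e : 'M[Osec V]_n), V x /\ splits (flag A k) e.
Proof.
have [V [P [Q [Vx PQ]]]] := rep_chart x.
by exists V, (P *m pid_mx k *m Q); split=> //; exact: flag_splits.
Qed.

(** In a chart, the action of [g] becomes the upper triangular matrix [Q rho(g) P], which preserves
    the span of the first [k] basis vectors. *)
Lemma flag_invariant k : Defs.invariant rho (flag A k).
Proof.
move=> g U v Ev V h P Q PQ; have [[PQ1 QP1] AP] := PQ.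
have := Ev V h P Q PQ; rewrite mx_resM rep_res_res => ev.
have /(AP V (@subset_refl _ V)) := rep_algebra_rep g V; rewrite !mx_res_refl.
move=> /(@upper_triangular_pid _ _ _ k)/(congr1 (fun B => P *m B *m (Q *m mx_res h v))).
rewrite !mulmxA PQ1 mul1mx -!mulmxA.
rewrite [P *m (pid_mx k *m (Q *m mx_res h v))]mulmxA.
by rewrite [_ *m (Q *m mx_res h v)]mulmxA ev.
Qed.

Lemma flag_leq k l U : (k <= l)%N -> flag A k U `<=` flag A l U.
Proof.
move=> kl v Ev V h P Q PQ; have [[_ QP] _] := PQ.
rewrite -(Ev V h P Q PQ) -!mulmxA [Q *m (P *m _)]mulmxA QP mul1mx.
by rewrite [pid_mx l *m (pid_mx k *m _)]mulmxA pid_mx_absorb.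
Qed.

Lemma chart_factor k V (P Q : 'M[Osec V]_n) : (k <= n)%N -> mx_inverse P Q ->
  (pid_mx k *m Q) *m (P *m pid_mx k) = (1%:M : 'M_k) /\
  P *m pid_mx k *m Q = P *m (pid_mx k : 'M_(n, k)) *m ((pid_mx k : 'M_(k, n)) *m Q).
Proof.
move=> kn [_ QP]; have [K L] := pid_mx_factor (Osec V) kn.
split; first by rewrite -mulmxA [Q *m (P *m _)]mulmxA QP mul1mx K.
by rewrite !mulmxA -[P *m _ *m pid_mx k]mulmxA L.
Qed.

(** In a chart, the first [k] columns of [P] form a basis of the subsheaf, and the remaining columns
    map to a basis of the quotient. *)
Lemma flag_subbundle k : (k <= n)%N -> subbundle k (flag A k).
Proof.
move=> kn; split=> [x|].
  have [V [P [Q [Vx PQ]]]] := rep_chart x.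
  have [DC eCD] := chart_factor kn PQ.1.
  exact: (splits_free_near Vx (flag_splits k PQ) DC eCD).
exists (sub_omod (image_sub (cosplit (flag A k)))), (corestrict (cosplit (flag A k))).
split=> [|x].
  by apply: corestrict_quotient => U s; apply: cosplit_kernel; exact: flag_locally_split.
have [V [P [Q [Vx PQ]]]] := rep_chart x; have [[PQ1 QP] _] := PQ.
have [s [K [L [LK KL]]]] := copid_mx_factor (Osec V) kn.
exists s; apply: (cosplit_free_near (flag_locally_split k) Vx (flag_splits k PQ)
  (C := P *m K) (D := L *m Q)).
  by rewrite -mulmxA [Q *m (P *m _)]mulmxA QP mul1mx.
by rewrite mulmxA -[P *m K *m L]mulmxA -KL mulmxBr mulmx1 mulmxBl PQ1.
Qed.

(** The two identities say that [e] and [f] have the same image. *)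
Lemma splits_change (E : submodule (mx_omod X n 1)) V (e f : 'M[Osec V]_n) :
  splits E e -> e *m f = f -> f *m e = e -> splits E f.
Proof.
move=> [ee Ee] ef fe; split=> [|W h v]; first by rewrite -{2}ef mulmxA fe.
by rewrite (Ee W h); split=> <-; rewrite mulmxA -mx_resM ?fe ?ef.
Qed.

Hypothesis local_X : locally_ringed X.

Lemma invariant_subbundle_chart k (E : submodule (mx_omod X n 1)) (x : X) :
  invariant_subbundle rho k E ->
  exists V (P Q : 'M[Osec V]_n),
    [/\ V x, borel_chart A P Q & splits E (P *m pid_mx k *m Q)].
Proof.
move=> [[Efree Equot] /invariant_rep_algebra Einv].
have [V [e [P [Q [Vx Ee PQ]]]]] : exists V (e P Q : 'M[Osec V]_n),
    [/\ V x, splits E e & borel_chart A P Q].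
  have [V0 [e [V0x Ee]]] := locally_free_quotient_splits x Equot.
  have [V1 [P [Q [V1x PQ]]]] := rep_chart x.
  exists (opensI V0 V1), (mx_res (opensIl V0 V1) e), (mx_res (opensIr V0 V1) P),
    (mx_res (opensIr V0 V1) Q).
  by split=> //; [exact: splits_res | exact: borel_chart_res].
have [[PQ1 QP] AP] := PQ.
(* In the coordinates of the chart, [p] is the complementary projector, whose kernel corresponds to
   [E]. *)
pose p := Q *m (1%:M - e) *m P.
have p1 : 1%:M - p = Q *m e *m P.
  by rewrite /p mulmxBr mulmx1 mulmxBl QP opprB addrCA subrr addr0.
have pinv (i j : 'I_n) : (i <= j)%N -> p *m delta_mx i j *m (1%:M - p) = 0.
  move=> ij; pose a := P *m delta_mx i j *m Q.
  have Aa : A V a.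
    apply/(AP V (@subset_refl _ V)); rewrite !mx_res_refl !mulmxA QP mul1mx.
    by rewrite -mulmxA QP mulmx1; exact: upper_triangular_delta.
  (* The columns of [e] lie in [E], which is stable under [a] as a section of the generated
     algebra. *)
  have eae : e *m (a *m e) = a *m e.
    apply/(splits_cols _ Ee) => l; rewrite colE -mulmxA -colE.
    by apply: Einv => //; move: l; apply/(splits_cols _ Ee); exact: Ee.1.
  transitivity (Q *m ((1%:M - e) *m (a *m e)) *m P).
    by rewrite p1 /p /a !mulmxA.
  by rewrite mulmxBl mul1mx eae subrr mulmx0 mul0mx.
(* Shrink once so that all [n] diagonal entries of [p] become 0 or 1 simultaneously; taking [i = j]
   in [pinv] shows that they are idempotent. *)
have [|j|W [Wx WV p01]] := @open_nbhs_forall X 'I_n x V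
    (fun j W => exists h : W `<=` V, Ores h (p j j) = 0 \/ Ores h (p j j) = 1) Vx.
- move=> j W W' l [h p01]; exists (subset_trans l h).
  by rewrite -(Ores_res h l); case: p01 => ->; rewrite ?rmorph0 ?rmorph1; auto.
- have pp : p j j * p j j = p j j.
    have := congr1 (fun B : 'M__ => B j j) (pinv j j (leqnn j)).
    rewrite mul_mx_delta_mx !mxE eqxx mulrBr mulr1 => /eqP.
    by rewrite subr_eq0 => /eqP.
  have [W [h [Wx p01]]] := idempotent_locally_trivial local_X Vx pp.
  by exists W; split=> //; exists h.
have [|j|k' [k'n pk' kp']] := @idempotent_kernel _ _ (mx_res WV p).
- move=> i j ij; rewrite -(map_delta_mx (Ores WV)) -(mx_res1 n WV).
  by rewrite -mx_resB -!mx_resM pinv ?mx_res0.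
- by have [h p01j] := p01 j; rewrite (Prop_irrelevance WV h) [mx_res _ _ _ _]mxE.
have EeW := splits_res WV Ee; have PQW := borel_chart_res WV PQ.
set e' := mx_res WV e in EeW; set P' := mx_res WV P in PQW.
set Q' := mx_res WV Q in PQW; have [[PQ1' QP'] _] := PQW.
have p'E : mx_res WV p = Q' *m (1%:M - e') *m P' by rewrite !mx_resE.
have p1'E : 1%:M - mx_res WV p = Q' *m e' *m P'.
  by rewrite -(mx_res1 n WV) -mx_resB p1 !mx_resE.
(* Conjugating [pk'] and [kp'] back by [P'] shows that [e'] and the idempotent of the chart have the
   same image. *)
have Ek' : splits E (P' *m pid_mx k' *m Q').
  apply: splits_change EeW _ _.
    apply/eqP; rewrite -subr_eq0 -oppr_eq0 opprB; apply/eqP.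
    have := congr1 (fun B => P' *m B *m Q') pk'.
    by rewrite p'E !mulmxA PQ1' mul1mx mulmx0 mul0mx !mulmxBl mul1mx.
  have := congr1 (fun B => P' *m B *m Q') kp'.
  rewrite p1'E !mulmxA PQ1' mul1mx -!mulmxA PQ1' !mulmx1.
  by [].
have [DC eCD] := chart_factor k'n PQW.1.
(* Near [x], [E] has rank [k] by assumption and rank [k'] by its splitting, and rings of sections
   around [x] are nonzero. *)
have -> : k = k'.
  apply: (splits_rank Wx Ek' DC eCD) (Efree x) => U Ux.
  exact: locally_ringed_nontrivial Ux.
by exists W, P', Q'.
Qed.

Lemma invariant_subbundle_flag k (E : submodule (mx_omod X n 1)) :
  invariant_subbundle rho k E -> flag A k = E.
Proof.
move=> Einv; apply: splits_local_ext => x.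
have [V [P [Q [Vx PQ EPQ]]]] := invariant_subbundle_chart x Einv.
by exists V, (P *m pid_mx k *m Q); split=> //; exact: flag_splits.
Qed.

Lemma flag_unique k : (k <= n)%N -> unique (invariant_subbundle rho k) (flag A k).
Proof.
move=> kn; split; last exact: invariant_subbundle_flag.
by split; [exact: flag_subbundle | exact: flag_invariant].
Qed.

Lemma invariant_flag_unique :
  unique (invariant_flag rho) (fun i : 'I_n.-1 => flag A i.+1).
Proof.
have ltn_pred (i : 'I_n.-1) : (i < n)%N := leq_trans (ltn_ord i) (leq_pred n).
split=> [|E [Einv _]].
  split=> [i|i j U ij]; first by have [] := flag_unique (ltn_pred i).
  exact: flag_leq.
by apply: funext => i; exact: invariant_subbundle_flag.
Qed.

End Representation.
(** * Inverse images *)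

Section Pullback.
Variables (X Y : ringed_space) (f : ringed_mor X Y).
Implicit Types (U W : opens X) (V : opens Y).
Local Notation "f^-1 V" := (preim_opens (rm_cont f) V) (at level 8, V at level 8).
Local Notation pull V := (map_mx (rm_sharp f V)).

Lemma preim_opens_sub (V' V : opens Y) : V' `<=` V -> f^-1 V' `<=` f^-1 V.
Proof. by move=> h x; exact: h. Qed.

Lemma pull_res m n V (V' : opens Y) (h : V' `<=` V) (k : f^-1 V' `<=` f^-1 V)
  (A : 'M[Osec V]_(m, n)) : pull V' (mx_res h A) = mx_res k (pull V A).
Proof. by apply/matrixP=> i j; rewrite !mxE; exact: rm_res. Qed.

Section InverseImage.
Variables (n : nat) (E : submodule (mx_omod Y n 1)) (F : submodule (mx_omod X n 1)).

(** One idempotent on an open of [Y] cuts out [E] there and, once pulled back, cuts out [F] on the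
    preimage. *)
Record pull_chart := PullChart {
  pc_open : opens Y; pc_mx : 'M[Osec pc_open]_n;
  pc_splits : splits E pc_mx;
  pc_pull : splits F (pull pc_open pc_mx) }.

Hypothesis charts : forall y : Y, exists c : pull_chart, pc_open c y.

Lemma pull_sub V (s : 'cV[Osec V]_n) : E V s -> F f^-1 V (pull V s).
Proof.
move=> Es; apply: (@sub_local _ _ F) => x Vx; have [c cx] := charts (f x).
have kV := preim_opens_sub (opensIl V (pc_open c)).
have kc := preim_opens_sub (opensIr V (pc_open c)).
exists f^-1 (opensI V (pc_open c)), kV; split=> //.
apply/((pc_pull c).2 _ kc); rewrite /= -(pull_res (opensIl _ _)).
rewrite -(pull_res (opensIr _ _)) -map_mxM; congr (pull _ _).
by apply/((pc_splits c).2 _ (opensIr _ _)); exact: sub_res Es.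
Qed.

Definition pull_fun V (s : sub_omod E V) : sub_omod F f^-1 V :=
  SubElt (pull_sub (sub_valP s)).

Lemma pull_funD V s t : @pull_fun V (s + t) = pull_fun s + pull_fun t.
Proof. by apply: sub_val_inj; exact: map_mxD. Qed.

Lemma pull_funZ V (a : Osec V) s :
  @pull_fun V (a *: s) = rm_sharp f V a *: pull_fun s.
Proof. by apply: sub_val_inj; exact: map_mxZ. Qed.

Lemma pull_fun_res V (V' : opens Y) (h : V' `<=` V) (k : f^-1 V' `<=` f^-1 V) s :
  @pull_fun V' (Mres h s) = Mres k (pull_fun s).
Proof. by apply: sub_val_inj; exact: pull_res. Qed.

Definition pull_fmap : omod_fmap f (sub_omod E) (sub_omod F) :=
  OModFMap pull_funD pull_funZ pull_fun_res.

Section Universal.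
Variables (N : omod X) (psi : omod_fmap f (sub_omod E) N).

Lemma of_0 V : psi V 0 = 0.
Proof. by rewrite -[0 in LHS](scale0r 0) of_Z rmorph0 scale0r. Qed.

Lemma of_sum V (I : finType) (s : I -> sub_omod E V) :
  psi V (\sum_i s i) = \sum_i psi V (s i).
Proof. by apply: (big_morph (psi V)); [exact: of_D | exact: of_0]. Qed.

Lemma pc_colP (c : pull_chart) j : E (pc_open c) (col j (pc_mx c)).
Proof. by move: j; apply/(splits_cols _ (pc_splits c)); case: (pc_splits c). Qed.

Definition pc_gen (c : pull_chart) j : sub_omod E (pc_open c) :=
  SubElt (pc_colP c j).

(* The columns of the idempotent of a chart generate [E] on it, with
   [v = sum_j v_j (col j e)] for every section [v] of [E]. *)
Definition local_ext (c : pull_chart) W (h : W `<=` f^-1 (pc_open c))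
    (v : 'cV[Osec W]_n) : N W :=
  \sum_j v j 0 *: Mres h (psi (pc_open c) (pc_gen c j)).

Lemma local_ext_res c W (W' : opens X) (h : W `<=` f^-1 (pc_open c))
    (k : W' `<=` W) (l : W' `<=` f^-1 (pc_open c)) v :
  Mres k (@local_ext c W h v) = local_ext l (mx_res k v).
Proof.
rewrite /local_ext Mres_sum; apply: eq_bigr => j _.
by rewrite MresZ (Mres_res _ _ l) mxE.
Qed.

Lemma local_extD c W (h : W `<=` f^-1 (pc_open c)) v w :
  local_ext h (v + w) = local_ext h v + local_ext h w.
Proof.
by rewrite /local_ext -big_split; apply: eq_bigr => j _; rewrite mxE scalerDl.
Qed.

Lemma local_extZ c W (h : W `<=` f^-1 (pc_open c)) a v :
  local_ext h (a *: v) = a *: local_ext h v.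
Proof.
rewrite /local_ext scaler_sumr; apply: eq_bigr => j _.
by rewrite mxE scalerA.
Qed.

(** Over the intersection of [V] with the chart, [s] is the combination of the columns of the
    idempotent with coefficients its own entries; apply [psi] to it. *)
Lemma local_ext_pull c V W (h : W `<=` f^-1 (pc_open c)) (k : W `<=` f^-1 V)
    (s : sub_omod E V) :
  Mres k (psi V s) = local_ext h (mx_res k (pull V (sub_val s))).
Proof.
pose V' := opensI V (pc_open c).
have kV := preim_opens_sub (opensIl V (pc_open c)).
have kc := preim_opens_sub (opensIr V (pc_open c)).
have kW : W `<=` f^-1 V' by move=> x Wx; split; [exact: (k x)|exact: (h x)].
have sE : Mres (opensIl V (pc_open c)) s =
    \sum_j Ores (opensIl V (pc_open c)) (sub_val s j 0) *:
      Mres (opensIr V (pc_open c)) (pc_gen c j).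
  apply: sub_val_inj; rewrite sub_val_sum /=.
  have [es _] := (pc_splits c).2 _ (opensIr V _) (mx_res (opensIl V _) (sub_val s)).
  rewrite -[LHS](es (sub_res _ (sub_valP s))) mulmx_sum_col; apply: eq_bigr => j _ /=.
  by rewrite mx_res_col mxE.
rewrite -(Mres_res kV kW k) -(of_res psi (opensIl _ _)) sE of_sum Mres_sum.
apply: eq_bigr => j _.
rewrite of_Z (of_res psi _ kc) MresZ (Mres_res _ _ h); congr (_ *: _).
by rewrite (rm_res _ kV) (Ores_res _ _ k) !mxE.
Qed.

(** By [local_ext_pull], the generators of the chart [c] have the same values when computed in [c'].
    Linearity then reduces the claim to [e v = v] for the pulled back idempotent [e] of [c], which
    holds on [F]. *)
Lemma local_ext_unique c (c' : pull_chart) W (h : W `<=` f^-1 (pc_open c))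
    (h' : W `<=` f^-1 (pc_open c')) (v : 'cV[Osec W]_n) :
  F W v -> local_ext h v = local_ext h' v.
Proof.
move=> Fv; rewrite [LHS]/local_ext.
under eq_bigr => j _ do rewrite (local_ext_pull h' h (pc_gen c j)) -local_extZ.
have local_ext0 : local_ext h' 0 = 0.
  by rewrite -[0 in LHS](scale0r 0) local_extZ scale0r.
rewrite -(big_morph (local_ext h') (local_extD h') local_ext0).
congr (local_ext h' _); have /((pc_pull c).2 W h) := Fv.
rewrite mulmx_sum_col => ev; rewrite -[RHS]ev; apply: eq_bigr => j _ /=.
by rewrite map_col mx_res_col.
Qed.

Lemma pull_charts_separated U (s t : N U) :
  (forall c W (h : W `<=` f^-1 (pc_open c)) (k : W `<=` U), Mres k s = Mres k t) ->
  s = t.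
Proof.
move=> st; apply: Mres_separated => x Ux; have [c cx] := charts (f x).
exists (opensI U f^-1 (pc_open c)), (opensIl _ _); split=> //.
exact: st (opensIr _ _) _.
Qed.

(** The local extensions glue over the preimages of the charts. The property determines [t], so
    linearity and compatibility with restriction can be checked on charts. *)
Lemma ext_exists U (v : sub_omod F U) : exists t : N U,
  forall c W (h : W `<=` f^-1 (pc_open c)) (k : W `<=` U),
    Mres k t = local_ext h (mx_res k (sub_val v)).
Proof.
have cover : U `<=` \bigcup_c opensI U f^-1 (pc_open c).
  by move=> x Ux; have [c cx] := charts (f x); exists c.
have [|t [tP _]] := Mres_sheaf (fun c => opensIl U f^-1 (pc_open c)) cover
    (s := fun c => local_ext (opensIr U f^-1 (pc_open c))
      (mx_res (opensIl U f^-1 (pc_open c)) (sub_val v))).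
  move=> c c' W Wc Wc'.
  have h : W `<=` f^-1 (pc_open c) := subset_trans Wc (opensIr _ _).
  have h' : W `<=` f^-1 (pc_open c') := subset_trans Wc' (opensIr _ _).
  have k : W `<=` U := subset_trans Wc (opensIl _ _).
  rewrite (local_ext_res _ _ h) (local_ext_res _ _ h') !(mx_res_res _ _ k).
  by apply: local_ext_unique; exact: sub_res (sub_valP v).
exists t => c W h k.
have WI : W `<=` opensI U f^-1 (pc_open c).
  by move=> x Wx; split; [exact: (k x)|exact: (h x)].
have := congr1 (Mres WI) (tP c).
by rewrite (Mres_res _ _ k) (local_ext_res _ _ h) (mx_res_res _ _ k).
Qed.

Definition ext_fun U (v : sub_omod F U) : N U := sval (cid (ext_exists v)).

Lemma ext_funP U (v : sub_omod F U) c W (h : W `<=` f^-1 (pc_open c))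
    (k : W `<=` U) : Mres k (ext_fun v) = local_ext h (mx_res k (sub_val v)).
Proof. exact: (svalP (cid (ext_exists v))). Qed.

Lemma ext_funD U v w : @ext_fun U (v + w) = ext_fun v + ext_fun w.
Proof.
apply: pull_charts_separated => c W h k.
by rewrite MresD !(ext_funP _ h) -local_extD mx_resD.
Qed.

Lemma ext_funZ U a v : @ext_fun U (a *: v) = a *: ext_fun v.
Proof.
apply: pull_charts_separated => c W h k.
by rewrite MresZ !(ext_funP _ h) -local_extZ mx_resZ.
Qed.

Lemma ext_fun_res U (U' : opens X) (l : U' `<=` U) v :
  @ext_fun U' (Mres l v) = Mres l (ext_fun v).
Proof.
apply: pull_charts_separated => c W h k.
have kl : W `<=` U := subset_trans k l.
by rewrite (Mres_res _ _ kl) !(ext_funP _ h) /= (mx_res_res _ _ kl).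
Qed.

Definition ext_hom : omod_hom (sub_omod F) N :=
  OModHom ext_funD ext_funZ ext_fun_res.

Lemma ext_hom_pull V (s : sub_omod E V) : ext_hom _ (pull_fmap V s) = psi V s.
Proof.
apply: pull_charts_separated => c W h k.
by rewrite (ext_funP _ h) (local_ext_pull h).
Qed.

(** Locally every section of [F] is a combination of pulled back columns, on which [theta] is
    prescribed. *)
Lemma ext_hom_unique (theta : omod_hom (sub_omod F) N) :
  (forall V (s : sub_omod E V), theta _ (pull_fmap V s) = psi V s) ->
  forall U v, ext_hom U v = theta U v.
Proof.
move=> thetaP U v; apply: pull_charts_separated => c W h k.
rewrite (ext_funP _ h) -oh_res /local_ext.
under eq_bigr => j _ do rewrite -thetaP -oh_res -oh_Z.
rewrite -oh_sum; congr (theta W _); apply: sub_val_inj.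
rewrite sub_val_sum /=.
have /((pc_pull c).2 W h) := sub_res k (sub_valP v).
rewrite mulmx_sum_col => ev; rewrite -[RHS]ev; apply: eq_bigr => j _ /=.
by rewrite map_col mx_res_col.
Qed.

End Universal.

Lemma omod_hom_ext (M N : omod X) (s t : omod_hom M N) :
  (forall U v, s U v = t U v) -> s = t.
Proof.
case: s t => [s sD sZ sr] [t tD tZ tr] /= st.
have e : s = t.
  by apply: functional_extensionality_dep => U; apply/funext => v.
case: _ / e tD tZ tr {st} => *.
by congr OModHom; exact: Prop_irrelevance.
Qed.

Lemma pull_inverse_image : is_inverse_image_sub f E F.
Proof.
exists pull_fmap; split=> // N psi; exists (ext_hom psi).
split=> [V s|theta thetaP]; first exact: ext_hom_pull.
by apply: omod_hom_ext; exact: ext_hom_unique.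
Qed.

End InverseImage.
End Pullback.

(** * The algebra of conjugated upper triangular matrices over an open *)

Lemma upper_triangularM (R : comPzRingType) n (s t : 'M[R]_n) :
  upper_triangular s -> upper_triangular t -> upper_triangular (s *m t).
Proof.
move=> us ut i j ji; rewrite mxE big1 // => l _.
case: (ltnP l i) => li; first by rewrite us ?mul0r.
by rewrite ut ?mulr0 // (leq_trans ji).
Qed.

Section ConjugateUpperTriangular.
Variables (X : ringed_space) (n : nat) (V : opens X) (P Q : 'M[Osec V]_n).
Hypothesis PQ : mx_inverse P Q.
Implicit Types U W : opens X.

(** No condition is imposed away from [V]. This gives a subalgebra on all of [X], as the definition
    of the generated algebra requires for comparison. *)
Definition conj_sec U : set 'M[Osec U]_n :=
  [set a | forall W (h : W `<=` V) (k : W `<=` U),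
     upper_triangular (mx_res h Q *m mx_res k a *m mx_res h P)].

Lemma conj_sec0 U : conj_sec (0 : 'M[Osec U]_n).
Proof.
by move=> W h k; rewrite mx_res0 mulmx0 mul0mx => i j _; rewrite mxE.
Qed.

Lemma conj_secD U (a b : 'M[Osec U]_n) :
  conj_sec a -> conj_sec b -> conj_sec (a + b).
Proof.
move=> ha hb W h k; rewrite mx_resD mulmxDr mulmxDl.
exact: (upper_triD (ha W h k) (hb W h k)).
Qed.

Lemma conj_secZ U (c : Osec U) (a : 'M[Osec U]_n) :
  conj_sec a -> conj_sec (c *: a).
Proof.
move=> ha W h k; rewrite mx_resZ -scalemxAr -scalemxAl.
exact: (upper_triZ _ (ha W h k)).
Qed.

Lemma conj_sec_res U W (h : W `<=` U) (a : 'M[Osec U]_n) :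
  conj_sec a -> conj_sec (mx_res h a).
Proof. by move=> ha Z l k; rewrite (mx_res_res h k (subset_trans k h)); apply: ha. Qed.

Lemma conj_sec_local U (a : 'M[Osec U]_n) :
  (forall x, U x -> exists W (h : W `<=` U), W x /\ conj_sec (mx_res h a)) ->
  conj_sec a.
Proof.
move=> loc W h k; apply: upper_tri_local => x Wx.
have [Z [l [Zx aZ]]] := loc x (k x Wx).
exists (opensI W Z), (opensIl W Z); split=> //.
have := aZ _ (subset_trans (opensIl W Z) h) (opensIr W Z).
have WZU := subset_trans (opensIl W Z) k.
by rewrite !mx_resM !(mx_res_res _ _ WZU) !(mx_res_res _ _ (subset_trans (opensIl W Z) h)).
Qed.

Definition conj_upper : submodule (mx_omod X n n) :=
  @SubModule X (mx_omod X n n) conj_sec conj_sec0 conj_secD conj_secZ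
    conj_sec_res conj_sec_local.

Lemma conj_upper_subalgebra : subalgebra conj_upper.
Proof.
move=> U; split=> [W h k|a b ha hb W h k]; have [PQ1 QP] := mx_inverse_res h PQ.
  rewrite mx_res1 mulmx1 QP => i j; rewrite mxE -val_eqE /= ltn_neqAle eq_sym.
  by case: eqP.
have := upper_triangularM (ha W h k) (hb W h k).
by rewrite mx_resM -!mulmxA [mx_res h P *m (_ *m _)]mulmxA PQ1 mul1mx.
Qed.

End ConjugateUpperTriangular.

(** * Pullback of the generated algebra and of its charts *)

Section PullbackRepresentation.
Variables (Gamma : group_or_monoid) (n : nat) (X Y : ringed_space).
Variables (f : ringed_mor X Y).
Variables (sigma : representation Gamma n Y) (rho : representation Gamma n X).
Hypothesis rho_pullback : forall g, Defs.pullback f sigma g = rho g.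
Implicit Types (U V : opens Y) (W : opens X).
Local Notation "f^-1 V" := (preim_opens (rm_cont f) V) (at level 8, V at level 8).
Local Notation pull V := (map_mx (rm_sharp f V)).
Local Notation A := (rep_algebra sigma).
Local Notation B := (rep_algebra rho).

Lemma pull_rep_res g V : pull V (rep_res sigma V g) = rep_res rho f^-1 V g.
Proof.
have k : f^-1 V `<=` f^-1 (opensT Y) by [].
by rewrite (pull_res _ k) /rep_res -rho_pullback /Defs.pullback (mx_res_res _ _ k).
Qed.

Definition comap_sec U : set 'M[Osec U]_n := [set a | B f^-1 U (pull U a)].

Lemma comap_sec0 U : comap_sec (0 : 'M[Osec U]_n).
Proof. by rewrite /comap_sec /= map_mx0; exact: (sub_0 B). Qed.

Lemma comap_secD U (a b : 'M[Osec U]_n) :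
  comap_sec a -> comap_sec b -> comap_sec (a + b).
Proof. by rewrite /comap_sec /= map_mxD; exact: (@sub_D _ _ B). Qed.

Lemma comap_secZ U (c : Osec U) (a : 'M[Osec U]_n) :
  comap_sec a -> comap_sec (c *: a).
Proof. by rewrite /comap_sec /= map_mxZ; exact: (@sub_Z _ _ B). Qed.

Lemma comap_sec_res U V (h : V `<=` U) (a : 'M[Osec U]_n) :
  comap_sec a -> comap_sec (mx_res h a).
Proof.
rewrite /comap_sec /= (pull_res h (preim_opens_sub h)).
exact: (@sub_res _ _ B).
Qed.

Lemma comap_sec_local U (a : 'M[Osec U]_n) :
  (forall y, U y -> exists V (h : V `<=` U), V y /\ comap_sec (mx_res h a)) ->
  comap_sec a.
Proof.
move=> loc; apply: (@sub_local _ _ B) => x Ux.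
have [V [h [Vx aV]]] := loc (f x) Ux.
exists f^-1 V, (preim_opens_sub h); split=> //.
by move: aV; rewrite /comap_sec /= (pull_res h (preim_opens_sub h)).
Qed.

Definition comap_algebra : submodule (mx_omod Y n n) :=
  @SubModule Y (mx_omod Y n n) comap_sec comap_sec0 comap_secD comap_secZ
    comap_sec_res comap_sec_local.

Lemma rep_algebra_subalgebra : subalgebra B.
Proof.
move=> W; split=> [C CP _|a b ha hb C CP Crho]; first by have [] := CP W.
by have [_] := CP W; apply; [exact: ha | exact: hb].
Qed.

Lemma comap_algebra_subalgebra : subalgebra comap_algebra.
Proof.
move=> U; have [B1 BM] := rep_algebra_subalgebra f^-1 U.
split=> [|a b ha hb]; rewrite /= /comap_sec /= ?map_mx1 ?map_mxM //.
exact: BM.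
Qed.

(** The matrices whose pullback lies in [B] form a subalgebra containing [sigma], hence containing
    [A]. *)
Lemma pull_rep_algebra U (a : 'M[Osec U]_n) : A U a -> B f^-1 U (pull U a).
Proof.
move=> /(_ comap_algebra comap_algebra_subalgebra); apply=> g V.
by rewrite /= /comap_sec /= pull_rep_res; exact: rep_algebra_rep.
Qed.

(** The conjugated upper triangular algebra contains [rho], because [Q sigma(g) P] has zeros below
    the diagonal and these pull back to zeros; so it contains [B]. Conversely each [P E_ij Q] with
    [i <= j] lies in [A], its pullback lies in [B], and these pullbacks span the conjugated
    algebra. *)
Lemma pull_borel_chart V (P Q : 'M[Osec V]_n) :
  borel_chart A P Q -> borel_chart B (pull V P) (pull V Q).
Proof.
move=> [PQ AP]; have [PQ1 QP] := PQ.
have PQ' : mx_inverse (pull V P) (pull V Q).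
  by rewrite /mx_inverse -!map_mxM PQ1 QP map_mx1.
split=> // W h a; have [PQ1' QP'] := mx_inverse_res h PQ'; split=> [Ba|ua].
  have Crho : contains_rep rho (conj_upper (pull V P) (pull V Q)).
    move=> g U W' k l; rewrite rep_res_res -(rep_res_res rho g k) -pull_rep_res.
    rewrite -!mx_resM -!map_mxM => i j ji; rewrite !mxE.
    have := (AP V (@subset_refl _ V) _).1 (rep_algebra_rep g V) i j ji.
    by rewrite !mx_res_refl mxE => ->; rewrite !rmorph0.
  have := Ba _ (conj_upper_subalgebra PQ') Crho W h (@subset_refl _ W).
  by rewrite mx_res_refl.
pose t := mx_res h (pull V Q) *m a *m mx_res h (pull V P).
have -> : a = mx_res h (pull V P) *m t *m mx_res h (pull V Q).
  by rewrite /t !mulmxA PQ1' mul1mx -mulmxA PQ1' mulmx1.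
(* Expand [t] in elementary matrices: the terms below the diagonal vanish, the others are multiples
   of pulled back sections of [A]. *)
rewrite [t]matrix_sum_delta mulmx_sumr mulmx_suml; apply: sub_sum => i.
rewrite mulmx_sumr mulmx_suml; apply: sub_sum => j.
case: (ltnP j i) => ij.
  by rewrite [t i j]ua // scale0r mulmx0 mul0mx; exact: (sub_0 B).
rewrite -scalemxAr -scalemxAl; apply: (@sub_Z _ _ B).
have Aij : A V (P *m delta_mx i j *m Q).
  apply/(AP V (@subset_refl _ V)); rewrite !mx_res_refl !mulmxA QP mul1mx.
  by rewrite -mulmxA QP mulmx1; exact: upper_triangular_delta.
have := @sub_res _ _ B _ _ h _ (pull_rep_algebra Aij).
by rewrite /= !map_mxM map_delta_mx !mx_resM {2}/mx_res map_delta_mx.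
Qed.

Lemma flag_inverse_image k : has_borel_mold sigma ->
  is_inverse_image_sub f (flag A k) (flag B k).
Proof.
move=> sigma_borel; apply: pull_inverse_image => y.
have [V [P [Q [Vy PQ]]]] := rep_chart sigma_borel y.
have e : splits (flag B k) (pull V (P *m pid_mx k *m Q)).
  by rewrite !map_mxM map_pid_mx; exact: flag_splits (pull_borel_chart PQ).
by exists (PullChart (flag_splits k PQ) e).
Qed.

End PullbackRepresentation.

Theorem theorem3p2 (Gamma : group_or_monoid) (n : nat) (n_gt0 : (0 < n)%N)
    (B : scheme) (sigma : representation Gamma n B)
    (B_represents : represents_borel sigma) :
  exists E : 'I_n.-1 -> submodule (mx_omod B n 1),
    unique (invariant_flag sigma) E /\
    forall (X : scheme) (rho : representation Gamma n X),
      has_borel_mold rho ->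
    forall f : scheme_mor X B, (forall g, pullback f sigma g = rho g) ->
    forall i : 'I_n.-1,
      exists Ei : submodule (mx_omod X n 1),
        unique (invariant_subbundle rho i.+1) Ei /\
        is_inverse_image_sub f (E i) Ei.
Proof.
have [sigma_borel _] := B_represents.
exists (fun i : 'I_n.-1 => flag (rep_algebra sigma) i.+1); split.
  exact: invariant_flag_unique sigma_borel (@scheme_local B).
(* The subbundle on [X] comes from the same construction applied to [rho], so its local idempotents
   are pullbacks of those on [B]. *)
move=> X rho rho_borel f rho_pullback i; exists (flag (rep_algebra rho) i.+1).
split; last exact: flag_inverse_image rho_pullback _ sigma_borel.
apply: flag_unique => //; first exact: scheme_local.
exact: leq_trans (ltn_ord i) (leq_pred n).
Qed.
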